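(* Fix an integer $m\ge 2$. For $\boldsymbol{n}=(n_1,\ldots,n_m)\in\mathbb{Z}_+^m$, $n=n_1+\cdots+n_m$, and $d\in\mathbb{N}$, let $h_d(\boldsymbol{n})=\dim\left(\mathcal{H}^d(M_n)\right)^{\mathrm{K}(\boldsymbol{n})}$. Then for each fixed $d$ the iterated limit \[ h_d=\lim_{n_1\to\infty}\cdots\lim_{n_m\to\infty}h_d(n_1,\ldots,n_m) \] exists, and \[ h_d=\lim_{n\to\infty}\dim\left(\mathcal{A}^m_n[d]\right)^{\mathrm{GL}_n}. \]
   Context: $M_n$ is the space of $n\times n$ complex matrices, with $\mathrm{GL}_n=\mathrm{GL}_n(\mathbb{C})$ acting by conjugation. The $\mathrm{GL}_n$-harmonic polynomials are $\mathcal{H}(M_n)=\{f\in\mathbb{C}[M_n]: \Delta f=0 \text{ for all } \Delta\in\mathbb{D}[M_n]^{\mathrm{GL}_n}\}$, where $\mathbb{D}[M_n]^{\mathrm{GL}_n}$ denotes the $\mathrm{GL}_n$-invariant constant-coefficient differential operators on $M_n$ without constant term (so harmonic means annihilated by all invariant operators of positive order); $\mathcal{H}^d(M_n)$ is its homogeneous degree-$d$ part. $\mathrm{K}(\boldsymbol{n})$ is the block-diagonal subgroup $\mathrm{GL}_{n_1}\times\cdots\times\mathrm{GL}_{n_m}$ of $\mathrm{GL}_n$, acting on $\mathcal{H}^d(M_n)$ by restriction of the conjugation action. For integers $r\ge1$, $e\ge 1$, let $\mathbb{C}[M_n^{r};e]$ denote the polynomial functions on $M_n^{r}=M_n\oplus\cdots\oplus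 M_n$ ($r$ copies) with the $\mathbb{N}$-grading in which homogeneous polynomials of (total) degree $j$ are placed in grade $ej$. Define the $\mathbb{N}$-graded algebra $\mathcal{A}^m_n=\mathbb{C}[M_n^{m-1};1]\otimes\mathbb{C}[M_n^{m-1};2]\otimes\mathbb{C}[M_n^{m-1};3]\otimes\cdots$ (restricted infinite tensor product: finite sums of tensors in which all but finitely many factors are $1$), with the tensor product grading, and let $\mathcal{A}^m_n[d]$ be its grade-$d$ component. $\mathrm{GL}_n$ acts on each factor by simultaneous conjugation on all copies of $M_n$, and diagonally on $\mathcal{A}^m_n$, preserving grades; $(\mathcal{A}^m_n[d])^{\mathrm{GL}_n}$ denotes the invariants. *)

(* Defs.v *)
From mathcomp Require Import all_boot all_algebra.
From mathcomp Require Import complex Rstruct.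
From mathcomp Require Import mpoly.
From Stdlib Require Import ClassicalEpsilon.

Set Implicit Arguments.
Unset Strict Implicit.
Unset Printing Implicit Defensive.

Import GRing.Theory.
Local Open Scope ring_scope.

Notation CC := (Rdefinitions.R[i]).

(* Finite-dimensional dimension of a subspace S of an (arbitrary)       *)
(* C-vector space V: the size of a basis of S (the value is irrelevant  *)
(* if S has no finite basis; all spaces used below are finite-dim).    *)
Definition has_dim (V : lmodType CC) (S : V -> Prop) (k : nat) : Prop :=
  exists v : 'I_k -> V,
    [/\ forall i, S (v i),
        forall a : 'I_k -> CC, \sum_(i < k) a i *: v i = 0 -> forall i, a i = 0
      & forall x, S x -> exists a : 'I_k -> CC, x = \sum_(i < k) a i *: v i].

Definition dimS (V : lmodType CC) (S : V -> Prop) : nat :=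
  epsilon (inhabits 0%N) (has_dim S).

(* Polynomial functions on M_n^T = (copies of M_n indexed by a finite   *)
(* type T): variables x^{(t)}_{ij}, t : T, i j : 'I_n.                 *)
Section PolyOnMatrices.
Variables (T : finType) (n : nat).

Definition mvar := (T * 'I_n * 'I_n)%type.
Definition nvar : nat := #|{: mvar}|.
Definition Pol := {mpoly CC[nvar]}.

Definition xcoord (t : T) (i j : 'I_n) : Pol := 'X_(enum_rank (t, i, j)).

Definition conj_subst (g : 'M[CC]_n) : nvar.-tuple Pol :=
  [tuple (let: (t, i, j) := enum_val k in
          \sum_(a < n) \sum_(b < n) ((invmx g) i a * g b j) *: xcoord t a b)
  | k < nvar].

Definition conj_act (g : 'M[CC]_n) (f : Pol) : Pol := f \mPo conj_subst g.

Definition diffop (q f : Pol) : Pol :=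
  \sum_(mm <- msupp q) q@_mm *: mderivm mm f.

Definition inv_diffop (q : Pol) : Prop :=
  forall g : 'M[CC]_n, g \in unitmx ->
    forall f : Pol, diffop q (conj_act g f) = conj_act g (diffop q f).

End PolyOnMatrices.

Definition PM (n : nat) := Pol unit n.

Definition harmonic (n : nat) (f : PM n) : Prop :=
  forall q : PM n, q@_0%MM = 0 -> inv_diffop q -> diffop q f = 0.

(* K(n): block diagonal subgroup GL_{n_1} x ... x GL_{n_m} of GL_n,     *)
(* n = n_1 + ... + n_m.  blk ns i = index of the block containing i.    *)
Definition blk (ns : seq nat) (i : nat) : nat :=
  count (fun k => (sumn (take k.+1 ns) <= i)%N) (iota 0 (size ns)).

Definition in_K (ns : seq nat) (g : 'M[CC]_(sumn ns)) : Prop :=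
  g \in unitmx /\
  forall i j : 'I_(sumn ns), blk ns i != blk ns j -> g i j = 0.

Definition hdim (ns : seq nat) (d : nat) : nat :=
  dimS (fun f : PM (sumn ns) =>
          [/\ f \is d.-homog, harmonic f & forall g, @in_K ns g -> conj_act g f = f]).

(* A^m_n[d]: the grade-d part of C[M_n^{m-1};1] (x) C[M_n^{m-1};2] (x) ...*)
(* Only the factors with e <= d contribute to grade d, so A^m_n[d] is     *)
(* the grade-d part of the polynomial ring in the variables             *)
(* x^{(e,k)}_{ij}, 1 <= e <= d, k < m-1, where x^{(e,k)}_{ij} has weight *)
(* e.  Copies are indexed by ('I_d * 'I_(m-1)), e = (index + 1).        *)
Definition Acopy (m d : nat) := ('I_d * 'I_m.-1)%type.

Definition Aweight (m d n : nat) (mm : 'X_{1.. nvar (Acopy m d) n}) : nat :=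
  (\sum_(v : mvar (Acopy m d) n) (v.1.1.1.+1 * mm (enum_rank v)))%N.

Definition in_Agrade (m d n : nat) (p : Pol (Acopy m d) n) : bool :=
  all (fun mm => Aweight mm == d) (msupp p).

Definition Adim (m n d : nat) : nat :=
  dimS (fun p : Pol (Acopy m d) n =>
          in_Agrade p /\ forall g : 'M[CC]_n, g \in unitmx -> conj_act g p = p).

Definition lim_nat (f : nat -> nat) (L : nat) : Prop :=
  exists N, forall k, (N <= k)%N -> f k = L.

Fixpoint iter_lim (m : nat) (f : seq nat -> nat) (L : nat) : Prop :=
  match m with
  | 0 => f [::] = L
  | m'.+1 => exists L' : nat -> nat,
      (forall k, (0 < k)%N -> iter_lim m' (fun s => f (k :: s)) (L' k))
      /\ lim_nat L' L
  end.

(* Main.v *)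
Require Import Defs.
From HB Require Import structures.
From mathcomp Require Import all_boot all_order all_algebra all_fingroup.
From mathcomp Require Import complex Rstruct.
From mathcomp Require Import mpoly.
From mathcomp Require Import ring zify.
From Stdlib Require Import ClassicalEpsilon FunctionalExtensionality.

Set Implicit Arguments.
Unset Strict Implicit.
Unset Printing Implicit Defensive.

Import Order.TTheory GRing.Theory Num.Theory.
Local Open Scope ring_scope.

(** A K(n)-invariant polynomial of degree d is a combination of products of traces of words in the
    matrix X and the block projections E_b. Such a product is encoded by a permutation of d points,
    whose cycles are the traces, with a label at each point for the diagonal matrix inserted before
    that letter X. With 1, E_1, E_2, ... as basis of the block scalars, a cycle labelled by 0 only
    is a full trace tr(X^k), and full traces generate the GL_n-invariants.

    For the pairing (p(∂)f)(0), multiplication is adjoint to differentiation. Hence the harmonic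
    invariants are the invariants orthogonal to the bad products, those with a full trace as a
    factor ([harmonic_bad], [bad_harmonic]), and h_d(n) is the dimension of all invariants minus
    that of the span of the bad ones ([block_harmonic_dim]). When every block has size at least d,
    nonisomorphic labelled permutations give linearly independent products ([uR_free]), so h_d(n) is
    the number of good classes, those with a nonzero label on every cycle. Restriction to smaller
    blocks makes h_d(n) nondecreasing in each n_i, and the number of classes bounds it. So the
    iterated limit exists and is the stable value ([hdim_iter_lim]).

    For n at least d, the invariants of A[d] have as basis the products of traces of total weight d
    in letters of weight e with one of the nonzero labels ([Adim_reps]). Cutting each cycle of a
    good labelled permutation before its nonzero labels turns a nonzero label followed by e-1 zeros
    into one letter of weight e, and this matches the two families ([card_good_reps]).

    The description by traces is [first_fundamental_theorem]. The coefficients of an invariant, read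
    as a symmetric tensor, form an operator commuting with the tensor powers of block matrices. By
    polarization these span the commutant of the place permutations and colour projections
    ([commutes_with_pattern]), and [double_commutant] writes the operator through the latter. *)

(** * Words in the matrix entries, symmetric coefficients and trace products *)

Section Words.
Variables (T : finType) (n : nat).
Local Notation mv := (mvar T n).

Definition wmon (X : finType) (v : X -> mv) : 'X_{1..nvar T n} :=
  (\sum_x U_(enum_rank (v x)))%MM.

Definition xword (X : finType) (v : X -> mv) : Pol T n :=
  \prod_x 'X_(enum_rank (v x)).

Lemma xwordE (X : finType) (v : X -> mv) : xword v = 'X_[wmon v].
Proof.
rewrite /xword /wmon; symmetry.
exact: (big_morph (fun m => 'X_[m] : Pol T n) (@mpolyXD _ _) (mpolyX0 _ _)).
Qed.

Lemma eq_xword (X : finType) (v w : X -> mv) : v =1 w -> xword v = xword w.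
Proof. by move=> e; apply: eq_bigr => x _; rewrite e. Qed.

Lemma eq_wmon (X : finType) (v w : X -> mv) : v =1 w -> wmon v = wmon w.
Proof. by move=> e; apply: eq_bigr => x _; rewrite e. Qed.

Lemma wmon_reindex (X Y : finType) (h : X -> Y) (v : Y -> mv) :
  bijective h -> wmon (v \o h) = wmon v.
Proof. by case=> k hK kK; rewrite /wmon [RHS](reindex h) //; exists k => x _. Qed.

Lemma xword_reindex (X Y : finType) (h : X -> Y) (v : Y -> mv) :
  bijective h -> xword (v \o h) = xword v.
Proof. by move=> hb; rewrite !xwordE wmon_reindex. Qed.

Lemma mdeg_wmon (X : finType) (v : X -> mv) : mdeg (wmon v) = #|X|.
Proof.
rewrite mdeg_sum (eq_bigr (fun=> 1%N)) ?sum1_card // => x _.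
exact: mdeg1.
Qed.

Lemma wmon_count (X : finType) (v : X -> mv) a :
  wmon v (enum_rank a) = count_mem a (codom v).
Proof.
rewrite mnm_sumE /codom /image_mem count_map -sum1_count enumT.
rewrite [RHS]big_mkcond; apply: eq_bigr => x _ /=.
by rewrite mnm1E (inj_eq enum_rank_inj); case: eqP.
Qed.

Lemma wmon_perm d (v w : 'I_d -> mv) :
  wmon v = wmon w -> exists s : {perm 'I_d}, forall x, v x = w (s x).
Proof.
move=> e; have pe : perm_eq (mktuple v) (mktuple w).
  apply/allP => a _ /=; rewrite /= -!/(codom _) -!/(image_mem _ _).
  by rewrite -!wmon_count e.
have /tuple_permP [s Es] := pe; exists s => x.
have /(congr1 (fun t => tnth t x)) : mktuple v = [tuple tnth (mktuple w) (s i) | i < d].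
  exact: val_inj.
by rewrite !tnth_mktuple.
Qed.

Lemma wmon_cover d (m : 'X_{1..nvar T n}) : mdeg m = d ->
  exists v : {ffun 'I_d -> mv}, wmon v = m.
Proof.
move=> dm; have /eqP sz : size (m2s m) == d by rewrite size_m2s dm.
have /eqP sz' := sz; pose t := Tuple sz'.
exists [ffun x => enum_val (tnth t x)]; apply/mnmP => k.
rewrite -[k]enum_valK wmon_count -{1}[m]s2mK mnmE.
have -> : m2s m = [seq tnth t x | x <- enum 'I_d] by rewrite map_tnth_enum.
rewrite /codom /image_mem count_map [RHS]count_map; apply: eq_count => x /=.
by rewrite ffunE (inj_eq enum_val_inj) enum_valK.
Qed.

(** The coefficients of the symmetric tensor representing [f]: a monomial's coefficient is shared
    equally among the words that spell it. *)
Definition wcoef d (f : Pol T n) (v : {ffun 'I_d -> mv}) : CC :=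
  f@_(wmon v) / #|[pred w : {ffun 'I_d -> mv} | wmon w == wmon v]|%:R.

Lemma wcoef_perm d f (s : {perm 'I_d}) (v : {ffun 'I_d -> mv}) :
  wcoef f [ffun x => v (s x)] = wcoef f v.
Proof.
rewrite /wcoef; have -> // : wmon [ffun x => v (s x)] = wmon v.
rewrite -(wmon_reindex v (h := s)); last by exists (s^-1)%g; [apply: permK|apply: permKV].
by apply: eq_wmon => x; rewrite ffunE.
Qed.

Lemma mcoeff_words d (c : {ffun 'I_d -> mv} -> CC) m :
  (\sum_(v : {ffun 'I_d -> mv}) c v *: xword (fun_of_fin v))@_m = \sum_(v : {ffun 'I_d -> mv} | wmon v == m) c v.
Proof.
rewrite linear_sum [RHS]big_mkcond; apply: eq_bigr => v _ /=.
by rewrite mcoeffZ xwordE mcoeffX; case: eqP; rewrite ?mulr1 ?mulr0.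
Qed.

Lemma fiber_neq0 d (v : {ffun 'I_d -> mv}) :
  #|[pred w : {ffun 'I_d -> mv} | wmon w == wmon v]|%:R != 0 :> CC.
Proof. by rewrite pnatr_eq0 -lt0n; apply/card_gt0P; exists v; rewrite inE. Qed.

Lemma homog_wordsE d (f : Pol T n) : f \is d.-homog ->
  f = \sum_(v : {ffun 'I_d -> mv}) wcoef f v *: xword v.
Proof.
move=> hf; apply/mpolyP => m; rewrite mcoeff_words.
have [dm|dm] := eqVneq (mdeg m) d; last first.
  rewrite (dhomog_nemf_coeff hf dm) big_pred0 // => v.
  by apply: contraNF dm => /eqP <-; rewrite mdeg_wmon card_ord.
have [v0 <-] := wmon_cover dm.
rewrite (eq_bigr (fun=> wcoef f v0)) => [|v /eqP ev]; last by rewrite /wcoef ev.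
by rewrite sumr_const /wcoef -[_ *+ _]mulr_natr mulfVK ?fiber_neq0.
Qed.

(** Words with the same monomial differ by a permutation of places, so symmetric coefficients are
    constant on the fibres of [wmon], and a monomial coefficient is that constant times the fibre
    size. *)
Lemma word_coef_uniq d (c c' : {ffun 'I_d -> mv} -> CC) :
  (forall (s : {perm 'I_d}) (v : {ffun 'I_d -> mv}), c [ffun x => v (s x)] = c v) ->
  (forall (s : {perm 'I_d}) (v : {ffun 'I_d -> mv}), c' [ffun x => v (s x)] = c' v) ->
  \sum_v c v *: xword (fun_of_fin v) = \sum_v c' v *: xword (fun_of_fin v) -> c =1 c'.
Proof.
move=> hc hc' e v.
have fib (b : {ffun 'I_d -> mv} -> CC) :
    (forall (s : {perm 'I_d}) (v : {ffun 'I_d -> mv}), b [ffun x => v (s x)] = b v) ->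
    \sum_(w : {ffun 'I_d -> mv} | wmon w == wmon v) b w
      = b v * #|[pred w : {ffun 'I_d -> mv} | wmon w == wmon v]|%:R.
  move=> hb; rewrite (eq_bigr (fun=> b v)) ?sumr_const ?mulr_natr // => w /eqP.
  case/wmon_perm=> s Es; rewrite -(hb s v); congr b.
  by apply/ffunP => x; rewrite ffunE.
have := congr1 (mcoeff (wmon v)) e; rewrite !mcoeff_words !fib //.
exact: (mulIf (fiber_neq0 v)).
Qed.

(** With D_x the diagonal matrix of [c x], this is the product, over the cycles (x, s x, ...) of
    [s], of the traces tr(D_x X^{tau x} D_{s x} X^{tau (s x)} ...). *)
Definition tpoly (X : finType) (tau : X -> T) (s : {perm X})
    (c : X -> 'I_n -> CC) : Pol T n :=
  \sum_(I : {ffun X -> 'I_n})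
    (\prod_x c x (I x)) *: xword (fun x => (tau x, I x, I (s x))).

Lemma eq_tpoly (X : finType) (tau tau' : X -> T) (s : {perm X})
    (c c' : X -> 'I_n -> CC) :
  tau =1 tau' -> (forall x i, c x i = c' x i) -> tpoly tau s c = tpoly tau' s c'.
Proof.
move=> et ec; apply: eq_bigr => I _; congr (_ *: _).
  by apply: eq_bigr => x _; rewrite ec.
by apply: eq_xword => x; rewrite et.
Qed.

Lemma tpoly_homog (X : finType) (tau : X -> T) (s : {perm X})
    (c : X -> 'I_n -> CC) : tpoly tau s c \is #|X|.-homog.
Proof.
apply: rpred_sum => I _; apply: rpredZ.
by rewrite xwordE dhomogX; apply/eqP/mdeg_wmon.
Qed.

Lemma tpoly_reindex (X Y : finType) (h : X -> Y) (tau : Y -> T)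
    (s : {perm X}) (s' : {perm Y}) (c : Y -> 'I_n -> CC) :
  bijective h -> (forall x, h (s x) = s' (h x)) ->
  tpoly (tau \o h) s (c \o h) = tpoly tau s' c.
Proof.
move=> hb hs; have [k hK kK] := hb.
rewrite /tpoly (reindex (fun I : {ffun Y -> 'I_n} => [ffun x => I (h x)])) /=.
  apply: eq_bigr => I _; congr (_ *: _).
    rewrite [RHS](reindex h); last by exists k => x _.
    by apply: eq_bigr => x _; rewrite ffunE.
  by rewrite -(xword_reindex _ hb); apply: eq_xword => x; rewrite /= !ffunE hs.
exists (fun I : {ffun X -> 'I_n} => [ffun y => I (k y)]) => I _;
  by apply/ffunP => x; rewrite !ffunE ?hK ?kK.
Qed.

End Words.

(** * Linear substitutions of the variables *)

Section LinearSubstitution.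
Variables (T T' : finType) (n n' : nat).
Variable (K : mvar T n -> mvar T' n' -> CC).

(** Conjugation and restriction to a submatrix are both of this form, so the chain rule and the
    behaviour on words are proved once for a general kernel [K]. *)
Definition lsub (f : Pol T n) : Pol T' n' :=
  f \mPo [tuple \sum_w K (enum_val k) w *: 'X_(enum_rank w) | k < nvar T n].

Lemma lsub_is_linear : linear lsub.
Proof. by move=> a f g; rewrite /lsub linearP. Qed.
HB.instance Definition _ := GRing.isLinear.Build CC (Pol T n) (Pol T' n') _ lsub
  lsub_is_linear.

Lemma lsubZ a f : lsub (a *: f) = a *: lsub f.
Proof. exact: linearZ. Qed.

Lemma lsub_is_multiplicative : multiplicative lsub.
Proof. by split=> [f g|]; rewrite /lsub ?rmorphM ?rmorph1. Qed.
HB.instance Definition _ := GRing.isMultiplicative.Build (Pol T n) (Pol T' n') lsub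
  lsub_is_multiplicative.

Lemma lsubD f h : lsub (f + h) = lsub f + lsub h.
Proof. exact: raddfD. Qed.

Lemma lsub0 : lsub 0 = 0.
Proof. exact: raddf0. Qed.

Lemma lsub1 : lsub 1 = 1.
Proof. exact: rmorph1. Qed.

Lemma lsubM f h : lsub (f * h) = lsub f * lsub h.
Proof. exact: rmorphM. Qed.

Lemma lsub_sum (I : Type) (r : seq I) (P : pred I) (F : I -> Pol T n) :
  lsub (\sum_(i <- r | P i) F i) = \sum_(i <- r | P i) lsub (F i).
Proof. exact: raddf_sum. Qed.

Lemma lsubX v : lsub 'X_(enum_rank v) = \sum_w K v w *: 'X_(enum_rank w).
Proof.
rewrite /lsub comp_mpolyXU -tnth_nth tnth_mktuple.
by apply: eq_bigr => w _; rewrite enum_rankK.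
Qed.

Lemma lsub_word (X : finType) (v : X -> mvar T n) :
  lsub (xword v) =
  \sum_(w : {ffun X -> mvar T' n'}) (\prod_x K (v x) (w x)) *: xword w.
Proof.
rewrite /xword rmorph_prod /= (eq_bigr _ (fun x _ => lsubX (v x))).
rewrite bigA_distr_bigA; apply: eq_bigr => w _ /=.
by rewrite scaler_prod.
Qed.

End LinearSubstitution.

Lemma eq_lsub (T T' : finType) (n n' : nat) (K K' : mvar T n -> mvar T' n' -> CC)
    (f : Pol T n) : (forall v w, K v w = K' v w) -> lsub K f = lsub K' f.
Proof.
move=> e; suff -> : K = K' by [].
by apply: functional_extensionality => v; apply: functional_extensionality => w.
Qed.

(** * Conjugation and the invariance of trace products *)

Section Conjugation.
Variables (T : finType) (n : nat).
Local Notation mv := (mvar T n).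

Definition csub (g : 'M[CC]_n) (v w : mv) : CC :=
  (v.1.1 == w.1.1)%:R * (invmx g v.1.2 w.1.2 * g w.2 v.2).

Lemma csub_sum (g : 'M[CC]_n) t i j :
  \sum_(a < n) \sum_(b < n) ((invmx g) i a * g b j) *: xcoord t a b =
  \sum_w csub g (t, i, j) w *: 'X_(enum_rank w) :> Pol T n.
Proof.
pose F t' a b : Pol T n := csub g (t, i, j) (t', a, b) *: 'X_(enum_rank (t', a, b)).
transitivity (\sum_t' \sum_a \sum_b F t' a b).
  rewrite (bigD1 t) //= [X in _ + X]big1 ?addr0; last first.
    move=> t' /negPf tt; apply: big1 => a _; apply: big1 => b _.
    by rewrite /F /csub /= eq_sym tt mul0r scale0r.
  apply: eq_bigr => a _; apply: eq_bigr => b _.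
  by rewrite /F /csub /= eqxx mul1r.
rewrite (pair_bigA _ (fun t' a => \sum_b F t' a b)).
rewrite (pair_bigA _ (fun (p : T * 'I_n) b => F p.1 p.2 b)).
by apply: eq_bigr => -[[t' a] b] _.
Qed.

Lemma conj_actE (g : 'M[CC]_n) (f : Pol T n) : conj_act g f = lsub (csub g) f.
Proof.
rewrite /conj_act /lsub; suff -> : conj_subst T g =
    [tuple \sum_w csub g (enum_val k) w *: 'X_(enum_rank w) | k < nvar T n] by [].
apply: eq_from_tnth => k; rewrite [LHS]tnth_mktuple [RHS]tnth_mktuple.
case: (enum_val k) => [[t i] j]; exact: csub_sum.
Qed.

Lemma conj_act_is_linear (g : 'M[CC]_n) : linear (@conj_act T n g).
Proof. by move=> a f h; rewrite !conj_actE linearP. Qed.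
HB.instance Definition _ g := GRing.isLinear.Build CC (Pol T n) (Pol T n) _
  (@conj_act T n g) (conj_act_is_linear g).

Lemma conj_actM (g : 'M[CC]_n) (f h : Pol T n) :
  conj_act g (f * h) = conj_act g f * conj_act g h.
Proof. by rewrite !conj_actE rmorphM. Qed.

(** By hypothesis [g] commutes with every inserted diagonal matrix, so the factors of the
    conjugation cancel inside each trace. *)
Lemma tpoly_inv (X : finType) (tau : X -> T) (s : {perm X})
    (c : X -> 'I_n -> CC) (g : 'M[CC]_n) : g \in unitmx ->
  (forall x i j, g i j * c x j = c x i * g i j) ->
  conj_act g (tpoly tau s c) = tpoly tau s c.
Proof.
move=> gu gc; rewrite conj_actE /tpoly linear_sum /=.
pose F (w : {ffun X -> mv}) := \prod_x ((tau x == (w x).1.1)%:R *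
  (c x (w ((s^-1)%g x)).2 * (((w ((s^-1)%g x)).2 == (w x).1.2)%:R : CC))).
transitivity (\sum_(w : {ffun X -> mv}) F w *: xword w).
  under eq_bigr => I _ do rewrite linearZ /= lsub_word scaler_sumr.
  rewrite exchange_big /=; apply: eq_bigr => w _.
  under eq_bigr => I _ do rewrite scalerA.
  rewrite -scaler_suml; congr (_ *: _); rewrite /F.
  (* An entry of the identity D_x = g D_x g^-1, with D_x the diagonal matrix of [c x]. *)
  have cinv a b x : c x b * (b == a)%:R =
      \sum_i g b i * c x i * invmx g i a.
    under eq_bigr => i _ do rewrite gc -mulrA.
    rewrite -mulr_sumr; congr (_ * _).
    by have /matrixP/(_ b a) := mulmxV gu; rewrite !mxE.
  under [RHS]eq_bigr => x _ do rewrite cinv mulr_sumr.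
  rewrite bigA_distr_bigA; apply: eq_bigr => I _ /=.
  rewrite /csub /=.
  rewrite !big_split /=.
  have -> : \prod_x (g (w ((s^-1)%g x)).2 (I x)) = \prod_x (g (w x).2 (I (s x))) :> CC.
    by rewrite (reindex_perm s); apply: eq_bigr => x _; rewrite permK.
  ring.
(* A word has nonzero coefficient only if its column index at x is its row index at s x, which makes
   it a word of [tpoly]. *)
rewrite (bigID (fun w : {ffun X -> mv} =>
   w == [ffun x => (tau x, (w x).1.2, (w (s x)).1.2)])) /= [X in _ + X]big1 ?addr0.
  rewrite (reindex_onto (fun I : {ffun X -> 'I_n} => [ffun x => (tau x, I x, I (s x))])
     (fun w : {ffun X -> mv} => [ffun x => (w x).1.2])) /=; last first.
    by move=> w /eqP ew; apply/ffunP => x; rewrite {3}ew !ffunE.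
  apply: eq_big => [I|I _].
    apply/andP; split; apply/eqP/ffunP => x; rewrite !ffunE //=.
  congr (_ *: _); last by apply: eq_xword => x; rewrite ffunE.
  by apply: eq_bigr => x _; rewrite !ffunE /= permKV !eqxx mul1r mulr1.
move=> w nw; suff -> : F w = 0 by rewrite scale0r.
apply/eqP; apply: contraNT nw => /prodf_neq0 nF.
apply/eqP/ffunP => x; rewrite ffunE.
have := nF x isT; have := nF (s x) isT; rewrite permK.
case: (w x) => [[t a] b] /=.
case: (tau x =P t) => [->|]; last by rewrite mul0r eqxx.
case: (b =P _) => [->|]; last by rewrite !mulr0 eqxx.
by [].
Qed.

End Conjugation.

(** * The double commutant of place permutations and colour projections *)

Section DoubleCommutant.
Variable F : numFieldType.

(** The matrix E of [e] and its pseudo-inverse satisfy E E^+ E = E, so E^+ E is a linear map fixing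
    every row of E. *)
Lemma span_retract (O D : finType) (e : O -> D -> F) :
  exists a : D -> O -> F, forall o q,
    \sum_p e o p * (\sum_o' a p o' * e o' q) = e o q.
Proof.
pose E := \matrix_(i < #|O|, j < #|D|) e (enum_val i) (enum_val j).
exists (fun p o => pinvmx E (enum_rank p) (enum_rank o)) => o q.
have /matrixP/(_ (enum_rank o) (enum_rank q)) := mulmxKpV (submx_refl E).
rewrite -mulmxA mxE [RHS]mxE !enum_rankK => <-.
rewrite (reindex (@enum_val D D)) /=; last exact/onW_bij/enum_val_bij.
apply: eq_bigr => i _; rewrite /E mxE enum_rankK enum_valK; congr (_ * _).
rewrite mxE (reindex (@enum_val O O)) /=; last exact/onW_bij/enum_val_bij.
by apply: eq_bigr => k _; rewrite !mxE enum_rankK enum_valK.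
Qed.

Variables (X L : finType) (n : nat) (bl : 'I_n -> L).
Local Notation tens := {ffun X -> 'I_n}.

Definition fperm (Y : Type) (I : {ffun X -> Y}) (s : {perm X}) : {ffun X -> Y} :=
  [ffun x => I (s x)].

Lemma fpermM (Y : Type) (I : {ffun X -> Y}) (s t : {perm X}) :
  fperm (fperm I s) t = fperm I (t * s)%g.
Proof. by apply/ffunP => x; rewrite !ffunE permM. Qed.

Lemma fperm1 (Y : Type) (I : {ffun X -> Y}) : fperm I 1%g = I.
Proof. by apply/ffunP => x; rewrite !ffunE perm1. Qed.

Lemma fpermK (Y : Type) (s : {perm X}) :
  cancel (fun I : {ffun X -> Y} => fperm I s) (fun I => fperm I (s^-1)%g).
Proof. by move=> I; rewrite fpermM mulVg fperm1. Qed.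

Lemma fpermKV (Y : Type) (s : {perm X}) :
  cancel (fun I : {ffun X -> Y} => fperm I (s^-1)%g) (fun I => fperm I s).
Proof. by move=> I; rewrite fpermM mulgV fperm1. Qed.

Definition colour (I : tens) : {ffun X -> L} := [ffun x => bl (I x)].

Lemma colour_perm I s : colour (fperm I s) = fperm (colour I) s.
Proof. by apply/ffunP => x; rewrite !ffunE. Qed.

(* The matrices commuting with place permutations and colour projections. *)
Definition pattern (M : tens -> tens -> F) : Prop :=
  (forall s I J, M (fperm I s) (fperm J s) = M I J) /\
  (forall I J, colour I != colour J -> M I J = 0).

(* Averaging a linear retraction onto the span of the operators e over place
   permutations and colours makes all its blocks (fun I K => M J J' I K)
   patterns; commuting with them, C is mapped to C times the image of 1. *)
Lemma double_commutant (C : tens -> tens -> F) :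
  (forall M, pattern M -> forall I J,
     \sum_K C I K * M K J = \sum_K M I K * C K J) ->
  exists a : {perm X} -> {ffun X -> L} -> F, forall I J,
    C I J = \sum_s a s (colour I) * (J == fperm I s)%:R.
Proof.
move=> Ccomm.
pose e (o : {perm X} * {ffun X -> L}) (p : tens * tens) : F :=
  ((colour p.1 == o.2) && (p.2 == fperm p.1 o.1))%:R.
have [a ae] := span_retract e.
pose P K J' I J := \sum_o a (K, J') o * e o (I, J).
pose M J J' I K := (colour I == colour K)%:R *
  \sum_(s : {perm X}) P (fperm K s) J' (fperm I s) J.
have Mpat J J' : pattern (M J J').
  split=> [t I K|I K /negPf ne]; last by rewrite /M ne mul0r.
  rewrite /M !colour_perm (inj_eq (can_inj (fpermK t))); congr (_ * _).
  rewrite [RHS](reindex_inj (mulIg t)) /=.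
  by apply: eq_bigr => s _; rewrite !fpermM.
pose N : F := #|{: {perm X}}|%:R.
have N0 : N != 0 by rewrite pnatr_eq0 -lt0n; apply/card_gt0P; exists 1%g.
(* For each [s], the sum over J' is the retraction applied to one of the operators [e o], which it
   fixes. *)
have M1 J K : \sum_J' M J J' K J' = N * (K == J)%:R.
  rewrite /M; under eq_bigr => J' _ do rewrite mulr_sumr.
  rewrite exchange_big /= /N -sum1_card natr_sum mulr_suml.
  apply: eq_bigr => s _; rewrite mul1r.
  pose o := ((s^-1)%g, fperm (colour K) s).
  have <- : e o (fperm K s, J) = (K == J)%:R.
    by rewrite /e /= colour_perm eqxx fpermM mulVg fperm1 eq_sym.
  rewrite -ae [RHS](bigID (fun p => p.1 == fperm p.2 s)) /= [X in _ + X]big1 ?addr0; last first.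
    move=> [I J'] /= ne; rewrite /e /=; case: eqP => [|_]; last by rewrite mul0r.
    case: eqP => [EJ|_]; last by rewrite mul0r.
    by move: ne; rewrite EJ fpermM mulgV fperm1 eqxx.
  rewrite [RHS](reindex_onto (fun J' => (fperm J' s, J')) snd) /=; last first.
    by move=> [I J'] /= /eqP ->.
  apply: eq_big => [J'|J' _]; first by rewrite !eqxx.
  by rewrite /e /= colour_perm (inj_eq (can_inj (fpermK s))) fpermK eqxx andbT eq_sym.
pose A b s o := \sum_J' \sum_K (b == colour K)%:R * a (fperm K s, J') o * C K J'.
exists (fun r b => N^-1 * \sum_(s : {perm X}) A b s ((r * s^-1)%g, fperm b s)) => I J.
apply: (mulfI N0).
transitivity (\sum_J' \sum_K C I K * M J J' K J').
  rewrite exchange_big /=; under eq_bigr => K _ do rewrite -mulr_sumr M1.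
  rewrite (bigD1 J) //= eqxx big1 ?addr0; first by rewrite mulr1 mulrC.
  by move=> K /negPf ->; rewrite !mulr0.
under eq_bigr => J' _ do rewrite (Ccomm _ (Mpat J J')).
transitivity (\sum_(s : {perm X}) \sum_o A (colour I) s o * e o (fperm I s, J)).
  under [RHS]eq_bigr => s _ do (under eq_bigr => o _ do rewrite /A mulr_suml).
  under [RHS]eq_bigr => s _ do rewrite exchange_big.
  rewrite [RHS]exchange_big /=; apply: eq_bigr => J' _.
  under [RHS]eq_bigr => s _ do (under eq_bigr => o _ do rewrite mulr_suml).
  under [RHS]eq_bigr => s _ do rewrite exchange_big.
  rewrite [RHS]exchange_big /=; apply: eq_bigr => K _.
  rewrite /M mulrAC mulr_sumr; apply: eq_bigr => s _.
  rewrite /P mulr_sumr; apply: eq_bigr => o _; ring.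
rewrite [RHS]mulr_sumr.
under [RHS]eq_bigr => r _ do rewrite !mulrA mulfV // mul1r mulr_suml.
rewrite [RHS]exchange_big /=; apply: eq_bigr => s _.
rewrite [RHS](reindex_inj (mulIg s)) /=.
transitivity (\sum_t \sum_b A (colour I) s (t, b) * e (t, b) (fperm I s, J)).
  by rewrite pair_bigA; apply: eq_bigr => -[t b] _.
apply: eq_bigr => t _; rewrite mulgK (bigD1 (fperm (colour I) s)) //= big1 ?addr0.
  by rewrite /e /= colour_perm eqxx fpermM.
by move=> b /negPf nb; rewrite /e /= colour_perm eq_sym nb mulr0.
Qed.

End DoubleCommutant.

(** * Commutation with tensor powers of block matrices, by density and polarization *)

Lemma poly_nat_roots0 (F : numFieldType) (p : {poly F}) :
  (forall k : nat, p.[k%:R] = 0) -> p = 0.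
Proof.
move=> h; apply/eqP/negPn/negP => p0.
have := max_poly_roots p0 (rs := [seq (k%:R : F) | k <- iota 0 (size p)]).
rewrite size_map size_iota ltnn => big; apply: notF; apply: big.
  by apply/allP => _ /mapP [k _ ->]; rewrite /root h.
rewrite map_inj_uniq ?iota_uniq // => i j /eqP.
by rewrite eqr_nat => /eqP.
Qed.

Lemma sum_words (V : nmodType) (X T : finType) (n : nat)
    (f : {ffun X -> mvar T n} -> V) :
  \sum_v f v =
  \sum_(tau : {ffun X -> T}) \sum_(I : {ffun X -> 'I_n}) \sum_(J : {ffun X -> 'I_n})
    f [ffun x => (tau x, I x, J x)].
Proof.
under [RHS]eq_bigr => tau _ do rewrite pair_big /=.
rewrite pair_big /=.
rewrite (reindex (fun p : {ffun X -> T} * ({ffun X -> 'I_n} * {ffun X -> 'I_n}) =>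
   [ffun x => (p.1 x, p.2.1 x, p.2.2 x)])) //=.
exists (fun v : {ffun X -> mvar T n} =>
  ([ffun x => (v x).1.1], ([ffun x => (v x).1.2], [ffun x => (v x).2]))).
  move=> [tau [I J]] _ /=; congr (_, (_, _)); by apply/ffunP => x; rewrite !ffunE.
by move=> v _; apply/ffunP => x; rewrite !ffunE /=; case: (v x) => [[]].
Qed.

Section Polarization.
Variables (F : numFieldType) (X L : finType) (n : nat) (bl : 'I_n -> L).
Local Notation tens := {ffun X -> 'I_n}.

Definition commutes_with (D M : tens -> tens -> F) : Prop :=
  forall I J, \sum_K D I K * M K J = \sum_K M I K * D K J.

Definition tpow (g : 'I_n -> 'I_n -> F) (I J : tens) : F := \prod_x g (I x) (J x).

Lemma commutes_with_lin (O : finType) (D : tens -> tens -> F) (c : O -> F)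
    (M : O -> tens -> tens -> F) :
  (forall o, commutes_with D (M o) \/ c o = 0) ->
  commutes_with D (fun I J => \sum_o c o * M o I J).
Proof.
move=> h I J.
transitivity (\sum_o c o * \sum_K D I K * M o K J).
  under eq_bigr => K _ do rewrite mulr_sumr.
  rewrite exchange_big; apply: eq_bigr => o _; rewrite mulr_sumr.
  by apply: eq_bigr => K _; rewrite mulrCA.
transitivity (\sum_o c o * \sum_K M o I K * D K J).
  by apply: eq_bigr => o _; case: (h o) => [->|->] //; rewrite !mul0r.
under [RHS]eq_bigr => K _ do rewrite mulr_suml.
rewrite exchange_big; apply: eq_bigr => K _; rewrite mulr_sumr.
by apply: eq_bigr => o _; rewrite mulrA.
Qed.

Lemma commutes_with_ext (D M M' : tens -> tens -> F) : (forall I J, M I J = M' I J) ->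
  commutes_with D M -> commutes_with D M'.
Proof.
move=> e h I J; under eq_bigr => K _ do rewrite -e.
by under [RHS]eq_bigr => K _ do rewrite -e.
Qed.

Definition block_mx (g : 'I_n -> 'I_n -> F) : Prop :=
  forall i j, bl i != bl j -> g i j = 0.

(** The defect of commutation at g + k is a polynomial in k and vanishes when g + k is invertible.
    At the other k the characteristic polynomial of -g vanishes, so the product of the two is zero
    at every natural number. Hence the defect is zero, in particular at k = 0. *)
Lemma commutes_with_singular (D : tens -> tens -> F) :
  (forall g : 'M[F]_n, g \in unitmx -> block_mx g -> commutes_with D (tpow g)) ->
  forall g : 'M[F]_n, block_mx g -> commutes_with D (tpow g).
Proof.
move=> h g gb I J.
pose G (A B : tens) : {poly F} := \prod_x ((g (A x) (B x))%:P + (A x == B x)%:R *: 'X).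
pose p := \sum_K (D I K)%:P * G K J - \sum_K G I K * (D K J)%:P.
have GE A B k : (G A B).[k] = tpow (g + k%:M) A B.
  rewrite horner_prod; apply: eq_bigr => x _.
  by rewrite hornerD hornerC hornerZ hornerX !mxE mulr_natl.
have pE k : p.[k] = \sum_K D I K * tpow (g + k%:M) K J - \sum_K tpow (g + k%:M) I K * D K J.
  rewrite /p hornerD hornerN !horner_sum.
  by congr (_ - _); apply: eq_bigr => K _; rewrite hornerM hornerC GE.
suff p0 : p = 0.
  apply/eqP; rewrite -subr_eq0; apply/eqP.
  by have := pE 0; rewrite p0 horner0 raddf0 addr0 => <-.
have q0 : char_poly (- g) != 0 by apply/monic_neq0/char_poly_monic.
apply: (mulIf q0); rewrite mul0r; apply: poly_nat_roots0 => k.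
rewrite hornerM; have [u|nu] := boolP (g + (k%:R)%:M \in unitmx).
  rewrite pE h ?subrr ?mul0r // => i j ij; rewrite !mxE gb // add0r.
  by case: (i =P j) ij => [->|_ _]; rewrite ?eqxx ?mulr0n.
suff -> : (char_poly (- g)).[k%:R] = 0 by rewrite mulr0.
move: nu; rewrite unitmxE unitfE negbK => /eqP <-.
rewrite /char_poly -horner_evalE -det_map_mx; congr (\det _).
apply/matrixP => i j; rewrite !mxE.
by rewrite /= /horner_eval hornerD hornerMn hornerX hornerN hornerC opprK addrC.
Qed.

(** Ryser's formula for the permanent. Expand the right side over maps phi: the signed sum over the
    sets [e] containing the image of phi vanishes unless phi is onto, hence a permutation. *)
Lemma permanent_polarization (a : X -> X -> F) :
  \sum_(s : {perm X}) \prod_y a (s y) y =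
  \sum_(e : {ffun X -> bool}) (\prod_x (if e x then 1 else -1)) *
     \prod_y (\sum_x (e x)%:R * a x y).
Proof.
symmetry.
under eq_bigr => e _ do rewrite bigA_distr_bigA mulr_sumr.
rewrite exchange_big /=.
have key (phi : {ffun X -> X}) :
    \sum_(e : {ffun X -> bool}) (\prod_x (if e x then 1 else -1)) *
       (\prod_y ((e (phi y))%:R * a (phi y) y))
    = (injectiveb phi)%:R * \prod_y a (phi y) y.
  under [LHS]eq_bigr => e _ do rewrite big_split /= mulrA.
  rewrite -mulr_suml; congr (_ * _).
  pose f x (b : bool) : F := (if b then 1 else -1) * ((x \in codom phi) ==> b)%:R.
  transitivity (\sum_(e : {ffun X -> bool}) \prod_x f x (e x)).
    apply: eq_bigr => e _; rewrite /f big_split; congr (_ * _).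
    case: (boolP [forall y, e (phi y)]) => [/forallP h|].
      rewrite !big1 // => [x _|y _]; last by rewrite h.
      by case: (boolP (x \in _)) => // /codomP [y ->]; rewrite h.
    rewrite negb_forall => /existsP [y /negPf ny].
    rewrite (bigD1 y) //= ny mul0r (bigD1 (phi y)) //= ny codom_f mul0r.
    by [].
  rewrite -(bigA_distr_bigA f).
  under eq_bigr => x _ do rewrite big_bool /f /= implybT implybF !mulr1 mulN1r.
  have [inj|ninj] := boolP (injectiveb phi).
    rewrite big1 // => x _; have /injectiveP/injF_onto -> // := inj.
    by rewrite subr0.
  have /existsP [x nx] : [exists x, x \notin codom phi].
    rewrite -negb_forall; apply: contra ninj => /forallP h.
    have /image_injP inj : #|image phi (mem X)| == #|X|.
      by apply/eqP/eq_card => x; have := h x.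
    by apply/injectiveP => x y; apply: inj.
  by rewrite (bigD1 x) //= nx subrr mul0r.
under eq_bigr => phi _ do rewrite key.
rewrite (bigID (fun phi : {ffun X -> X} => injectiveb phi)) /= [X in _ + X]big1 ?addr0; last first.
  by move=> phi /negPf ->; rewrite mul0r.
rewrite (reindex_onto (val : {perm X} -> {ffun X -> X}) (insubd (1%g : {perm X}))) /=.
  apply: eq_big => [s|s _]; first by rewrite valKd eqxx (valP s).
  by rewrite (valP s) mul1r; apply: eq_bigr => y _; rewrite -pvalE.
exact: insubdK.
Qed.

(** A pattern is a combination of symmetrized tensor products of elementary matrices that join
    indices of equal colour. By polarization these are combinations of tensor powers of block
    matrices. *)
Lemma commutes_with_pattern (D : tens -> tens -> F) :
  (forall g : 'M[F]_n, g \in unitmx -> block_mx g -> commutes_with D (tpow g)) ->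
  forall M, pattern bl M -> commutes_with D M.
Proof.
move=> /commutes_with_singular h M [Mp Mc].
have hsum (a : X -> 'M[F]_n) : (forall x, block_mx (a x)) ->
    commutes_with D (fun I J => \sum_(s : {perm X}) \prod_y a (s y) (I y) (J y)).
  move=> ab; pose g (e : {ffun X -> bool}) := \sum_x (e x)%:R *: a x.
  apply: (@commutes_with_ext D (fun I J => \sum_(e : {ffun X -> bool})
    (\prod_x (if e x then 1 else -1)) * tpow (g e) I J)).
    move=> I J; rewrite (permanent_polarization (fun x y => a x (I y) (J y))).
    apply: eq_bigr => e _; congr (_ * _); apply: eq_bigr => y _.
    by rewrite /g summxE; apply: eq_bigr => x _; rewrite mxE.
  apply: commutes_with_lin => e; left; apply: h => i j ij.
  by rewrite /g summxE big1 // => x _; rewrite mxE ab // mulr0.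
pose N : F := #|{: {perm X}}|%:R.
have N0 : N != 0 by rewrite pnatr_eq0 -lt0n; apply/card_gt0P; exists 1%g.
apply: (@commutes_with_ext D (fun I J => \sum_(p : tens * tens) (N^-1 * M p.1 p.2) *
   \sum_(s : {perm X}) \prod_y (delta_mx (p.1 (s y)) (p.2 (s y)) : 'M[F]_n) (I y) (J y))).
  move=> I J; under eq_bigr => p _ do rewrite mulr_sumr.
  rewrite exchange_big /=.
  rewrite (eq_bigr (fun=> N^-1 * M I J)) => [|s _].
    by rewrite sumr_const /N -[_ *+ _]mulr_natl mulrA mulfV ?mul1r.
  rewrite (bigD1 (fperm I (s^-1)%g, fperm J (s^-1)%g)) //= [X in _ + X]big1 ?addr0.
    rewrite Mp big1 ?mulr1 // => y _.
    by rewrite !ffunE !permK mxE !eqxx.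
  move=> [A B] ne; rewrite [X in _ * X](_ : _ = 0) ?mulr0 //.
  apply/eqP; apply: contraNT ne => /prodf_neq0 ne.
  apply/eqP; congr (_, _); apply/ffunP => x; have := ne ((s^-1)%g x) isT;
    rewrite !ffunE !permKV mxE pnatr_eq0 eqb0 negbK => /andP [/eqP e1 /eqP e2] //.
apply: (@commutes_with_lin _ D (fun p : tens * tens => N^-1 * M p.1 p.2)
  (fun p I J => \sum_(s : {perm X})
     \prod_y (delta_mx (p.1 (s y)) (p.2 (s y)) : 'M[F]_n) (I y) (J y))) => -[A B] /=.
have [cAB|cAB] := eqVneq (colour bl A) (colour bl B); last by right; rewrite Mc // mulr0.
left; apply: (hsum (fun x => delta_mx (A x) (B x))) => x i j ij; rewrite mxE.
case: eqP => //= ei; case: eqP => //= ej; move: ij; rewrite ei ej.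
by have /ffunP/(_ x) := cAB; rewrite !ffunE => ->; rewrite eqxx.
Qed.

End Polarization.


(** * The first fundamental theorem for block-diagonal groups *)

Section FirstFundamentalTheorem.
Variables (T L : finType) (n : nat) (bl : 'I_n -> L).
Local Notation mv := (mvar T n).

Definition block_unit (g : 'M[CC]_n) : Prop :=
  g \in unitmx /\ forall i j, bl i != bl j -> g i j = 0.

Definition ctpoly (X : finType) (tau : X -> T) (s : {perm X}) (b : X -> L) : Pol T n :=
  tpoly tau s (fun x i => (bl i == b x)%:R).

Lemma wcoef_conj d (f : Pol T n) (g : 'M[CC]_n) : f \is d.-homog -> conj_act g f = f ->
  forall w : {ffun 'I_d -> mv},
  wcoef f w = \sum_(v : {ffun 'I_d -> mv}) wcoef f v * \prod_x csub g (v x) (w x).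
Proof.
move=> fh fg; apply: word_coef_uniq => [s w|s w|].
- exact: wcoef_perm.
- rewrite (reindex (fun v : {ffun 'I_d -> mv} => [ffun x => v (s x)])) /=; last first.
    by exists (fun v : {ffun 'I_d -> mv} => [ffun x => v ((s^-1)%g x)]) => v _;
      apply/ffunP => x; rewrite !ffunE ?permK ?permKV.
  apply: eq_bigr => v _; rewrite wcoef_perm; congr (_ * _).
  rewrite [RHS](reindex_perm s); apply: eq_bigr => x _.
  by rewrite !ffunE.
rewrite -(homog_wordsE fh) -{1}fg conj_actE {1}(homog_wordsE fh) linear_sum /=.
under eq_bigr => v _ do rewrite linearZ /= lsub_word scaler_sumr.
rewrite exchange_big /=; apply: eq_bigr => w _; rewrite scaler_suml.
by apply: eq_bigr => v _; rewrite scalerA.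
Qed.

(** For a fixed choice [tau] of copies, the coefficients form a matrix indexed by column words and
    row words. Invariance conjugates it by a tensor power of g, and moving one factor to the other
    side gives commutation. *)
Lemma wcoef_commutes d (f : Pol T n) (g : 'M[CC]_n) (tau : {ffun 'I_d -> T}) :
  f \is d.-homog -> conj_act g f = f -> g \in unitmx ->
  commutes_with (fun J I : {ffun 'I_d -> 'I_n} => wcoef f [ffun x => (tau x, I x, J x)])
    (tpow g).
Proof.
move=> fh fg gu B K.
pose c (I J : {ffun 'I_d -> 'I_n}) := wcoef f [ffun x => (tau x, I x, J x)].
have cE A : c A B = \sum_I \sum_J c I J * (tpow (invmx g) I A * tpow g B J).
  rewrite /c (wcoef_conj fh fg) sum_words (bigD1 tau) //= [X in _ + X]big1 ?addr0.
    apply: eq_bigr => I _; apply: eq_bigr => J _; congr (_ * _).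
    rewrite /tpow -big_split; apply: eq_bigr => x _.
    by rewrite !ffunE /csub /= eqxx mul1r.
  move=> tau' ne; apply: big1 => I _; apply: big1 => J _.
  have /existsP [x nx] : [exists x, tau' x != tau x].
    rewrite -negb_forall; apply: contra ne => /forallP h.
    by apply/eqP/ffunP => x; apply/eqP.
  by rewrite (bigD1 x) //= !ffunE /csub /= (negPf nx) !mul0r mulr0.
have inv I : \sum_A tpow (invmx g) I A * tpow g A K = (I == K)%:R.
  rewrite /tpow; under eq_bigr => A _ do rewrite -big_split /=.
  rewrite -(bigA_distr_bigA (fun x i => invmx g (I x) i * g i (K x))) /=.
  have E x : \sum_i invmx g (I x) i * g i (K x) = (I x == K x)%:R.
    by have /matrixP/(_ (I x) (K x)) := mulVmx gu; rewrite !mxE.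
  under eq_bigr => x _ do rewrite E.
  have [->|ne] := eqVneq I K; first by rewrite big1 // => x _; rewrite eqxx.
  have /existsP [x nx] : [exists x, I x != K x].
    rewrite -negb_forall; apply: contra ne => /forallP h.
    by apply/eqP/ffunP => x; apply/eqP.
  by rewrite (bigD1 x) //= (negPf nx) mul0r.
have mulr_swap (x y z t : CC) : x * (y * z) * t = (x * z) * (y * t) by ring.
transitivity (\sum_A c A B * tpow g A K) => //.
under eq_bigr => A _ do rewrite cE mulr_suml.
rewrite exchange_big /=.
rewrite (bigD1 K) //= [X in _ + X]big1 ?addr0; last first.
  move=> I /negPf ne; under eq_bigr => A _ do rewrite mulr_suml.
  rewrite exchange_big /= big1 // => J _.
  by under eq_bigr => A _ do rewrite mulr_swap; rewrite -mulr_sumr inv ne !mulr0.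
under eq_bigr => A _ do rewrite mulr_suml.
rewrite exchange_big /=; apply: eq_bigr => J _.
under eq_bigr => A _ do rewrite mulr_swap.
by rewrite -mulr_sumr inv eqxx mulr1 mulrC.
Qed.

(** The coefficient matrix of each [tau] commutes with all patterns, so it is a combination of place
    permutations with coefficients depending on colours, and each such term is a trace product. The
    second clause, that a type absent from [f] gets zero coefficients, serves to respect the weight
    grading later. *)
Theorem first_fundamental_theorem d (f : Pol T n) : f \is d.-homog ->
  (forall g, block_unit g -> conj_act g f = f) ->
  exists a : {ffun 'I_d -> T} -> {perm 'I_d} -> {ffun 'I_d -> L} -> CC,
    f = \sum_tau \sum_s \sum_b a tau s b *: ctpoly tau s b /\
    forall tau : {ffun 'I_d -> T},
      (forall v : {ffun 'I_d -> mv}, (forall x, (v x).1.1 = tau x) -> f@_(wmon v) = 0) ->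
      forall s b, a tau s b = 0.
Proof.
move=> fh finv.
pose c tau (J I : {ffun 'I_d -> 'I_n}) := wcoef f [ffun x => ((tau : {ffun _ -> T}) x, I x, J x)].
have ex tau : exists a : {perm 'I_d} -> {ffun 'I_d -> L} -> CC,
    (forall I J, c tau I J = \sum_s a s (colour bl I) * (J == fperm I s)%:R) /\
    ((forall I J, c tau I J = 0) -> forall s b, a s b = 0).
  have [z|nz] := boolP [forall I, forall J, c tau I J == 0].
    exists (fun _ _ => 0); split=> // I J.
    have /forallP/(_ I)/forallP/(_ J)/eqP -> := z.
    by rewrite big1 // => s _; rewrite mul0r.
  have [a aE] : exists a : {perm 'I_d} -> {ffun 'I_d -> L} -> CC,
      forall I J, c tau I J = \sum_s a s (colour bl I) * (J == fperm I s)%:R.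
    apply: double_commutant; apply: commutes_with_pattern => g gu gb.
    by apply: wcoef_commutes => //; apply: finv; split.
  exists a; split=> // z; case/negP: nz.
  by apply/forallP => I; apply/forallP => J; rewrite z.
have [a aP] := fin_all_exists ex.
(* [double_commutant] gives the row word as a rearrangement of the column word, with the colours on
   columns. Trace products go from rows to columns, so [s] is inverted and the colours move
   along. *)
exists (fun tau s b => a tau (s^-1)%g (fperm b s)); split; last first.
  move=> tau h s b; apply: (proj2 (aP tau)) => I J.
  by rewrite /c /wcoef h ?mul0r // => x; rewrite ffunE.
rewrite {1}(homog_wordsE fh) sum_words; apply: eq_bigr => tau _.
transitivity (\sum_s \sum_(J : {ffun 'I_d -> 'I_n})
    a tau s (colour bl J) *: xword (fun x => (tau x, fperm J s x, J x))).
  rewrite exchange_big [RHS]exchange_big /=; apply: eq_bigr => J _.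
  transitivity (\sum_(I : {ffun 'I_d -> 'I_n}) \sum_s
     (a tau s (colour bl J) * (I == fperm J s)%:R) *: xword (fun x => (tau x, I x, J x))).
    apply: eq_bigr => I _; rewrite -scaler_suml -(proj1 (aP tau)); congr (_ *: _).
    by apply: eq_xword => x; rewrite ffunE.
  rewrite exchange_big /=; apply: eq_bigr => s _.
  rewrite (bigD1 (fperm J s)) //= [X in _ + X]big1 ?addr0 ?eqxx ?mulr1 // => I /negPf ->.
  by rewrite mulr0 scale0r.
rewrite (reindex_inj invg_inj) /=; apply: eq_bigr => s _.
rewrite (reindex (fun I : {ffun 'I_d -> 'I_n} => fperm I s)) /=; last first.
  exact/onW_bij/(Bijective (fpermK s) (fpermKV s)).
under [RHS]eq_bigr => b _ do rewrite scaler_sumr.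
rewrite [RHS]exchange_big /=; apply: eq_bigr => I _.
rewrite (bigD1 (colour bl I)) //= [X in _ + X]big1 ?addr0.
  rewrite colour_perm fpermK big1 ?scale1r => [|x _]; last by rewrite ffunE eqxx.
  by congr (_ *: _); apply: eq_xword => x; rewrite ffunE.
move=> b ne.
have /existsP [x nx] : [exists x, bl (I x) != b x].
  rewrite -negb_forall; apply: contra ne => /forallP h.
  by apply/eqP/ffunP => x; rewrite ffunE; apply/esym/eqP.
by rewrite (bigD1 x) //= (negPf nx) mul0r scale0r scaler0.
Qed.

End FirstFundamentalTheorem.

(** * Polynomial induction and constant-coefficient differential operators *)

Section PolynomialInduction.
Variables (T : finType) (n : nat).

Lemma Pol_ind (P : Pol T n -> Prop) :
  P 1 -> (forall v : mvar T n, P 'X_(enum_rank v)) ->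
  (forall (a : CC) f, P f -> P (a *: f)) -> (forall f h, P f -> P h -> P (f + h)) ->
  (forall f h, P f -> P h -> P (f * h)) -> forall f, P f.
Proof.
move=> P1 PX PZ PD PM f.
have P0 : P 0 by rewrite -(scale0r (1 : Pol T n)); apply: PZ.
rewrite (mpolyE f); apply: big_ind => // m _; apply: PZ.
have [v <-] := wmon_cover (erefl (mdeg m)); rewrite -xwordE.
by apply: big_ind => // x _.
Qed.

Lemma msupp_sum_extend (V : lmodType CC) (q : Pol T n) (G : 'X_{1..nvar T n} -> V) r :
  uniq r -> {subset msupp q <= r} ->
  \sum_(m <- msupp q) q@_m *: G m = \sum_(m <- r) q@_m *: G m.
Proof.
move=> ur sr; rewrite [RHS](bigID (fun m => m \in msupp q)) /= [X in _ + X]big1 ?addr0.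
  rewrite -[RHS]big_filter; apply: perm_big; apply: uniq_perm; rewrite ?filter_uniq ?msupp_uniq //.
  by move=> m; rewrite mem_filter; case: (boolP (m \in msupp q)) => // /sr.
by move=> m nm; rewrite memN_msupp_eq0 // scale0r.
Qed.

End PolynomialInduction.

Section DifferentialOperators.
Variables (T : finType) (n : nat).
Local Notation mv := (mvar T n).
Implicit Types (p q f : Pol T n).

Lemma diffop_is_linear q : linear (@diffop T n q).
Proof.
move=> a f h; rewrite /diffop scaler_sumr -big_split; apply: eq_bigr => m _.
by rewrite mderivmD mderivmZ scalerDr !scalerA mulrC.
Qed.
HB.instance Definition _ q := GRing.isLinear.Build CC (Pol T n) (Pol T n) _
  (@diffop T n q) (diffop_is_linear q).

Lemma diffop_linl f a p q : diffop (a *: p + q) f = a *: diffop p f + diffop q f.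
Proof.
pose r := undup (msupp (a *: p + q) ++ msupp p ++ msupp q).
have sub (h : Pol T n) : {subset msupp h <= msupp (a *: p + q) ++ msupp p ++ msupp q} ->
    diffop h f = \sum_(m <- r) h@_m *: f^`M[m].
  move=> sh; apply: msupp_sum_extend; first exact: undup_uniq.
  by move=> m /sh; rewrite mem_undup.
rewrite !sub; first last.
- by move=> m mh; rewrite mem_cat mh.
- by move=> m mh; rewrite !mem_cat mh orbT.
- by move=> m mh; rewrite !mem_cat mh !orbT.
rewrite scaler_sumr -big_split; apply: eq_bigr => m _.
by rewrite mcoeffD mcoeffZ scalerDl scalerA.
Qed.

Lemma diffopDl p q f : diffop (p + q) f = diffop p f + diffop q f.
Proof. by rewrite -[p]scale1r diffop_linl !scale1r. Qed.

Lemma diffop0l f : diffop 0 f = 0.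
Proof. by rewrite /diffop msupp0 big_nil. Qed.

Lemma diffopZl a p f : diffop (a *: p) f = a *: diffop p f.
Proof. by rewrite -[a *: p]addr0 diffop_linl diffop0l !addr0. Qed.

Lemma diffop_suml (I : Type) (r : seq I) (P : pred I) (q : I -> Pol T n) f :
  diffop (\sum_(i <- r | P i) q i) f = \sum_(i <- r | P i) diffop (q i) f.
Proof.
by apply: (big_morph (fun q => diffop q f)) => [p h|]; rewrite ?diffopDl ?diffop0l.
Qed.

Lemma diffop_mon m f : diffop ('X_[m] : Pol T n) f = f^`M[m].
Proof. by rewrite /diffop msuppX big_seq1 mcoeffX eqxx scale1r. Qed.

Lemma diffop_var (v : mv) f :
  diffop ('X_(enum_rank v) : Pol T n) f = f^`M(enum_rank v).
Proof. by rewrite diffop_mon mderivmU1m. Qed.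

Lemma diffop1 f : diffop 1 f = f.
Proof. by rewrite -(mpolyX0 _ _) diffop_mon mderivm0m. Qed.

Lemma diffopM p q f : diffop (p * q) f = diffop p (diffop q f).
Proof.
rewrite [p]mpolyE mulr_suml !diffop_suml; apply: eq_bigr => m _.
rewrite -scalerAl !diffopZl; congr (_ *: _).
rewrite [q]mpolyE mulr_sumr !diffop_suml linear_sum; apply: eq_bigr => m' _.
by rewrite -scalerAr !diffopZl linearZ /= -mpolyXD !diffop_mon addmC mderivmDm.
Qed.

End DifferentialOperators.

Lemma pihomog_sum (T : finType) (n d : nat) (I : Type) (r : seq I) (P : pred I)
    (F : I -> Pol T n) :
  pihomog mdeg d (\sum_(i <- r | P i) F i) = \sum_(i <- r | P i) pihomog mdeg d (F i).
Proof. exact: raddf_sum. Qed.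

(** * Differential operators and degrees under linear substitution *)

Section ChainRule.
Variables (T T' : finType) (n n' : nat) (K : mvar T n -> mvar T' n' -> CC).

Lemma mderiv_lsub (f : Pol T n) u :
  (lsub K f)^`M(enum_rank u) = \sum_v K v u *: lsub K f^`M(enum_rank v).
Proof.
elim/Pol_ind: f => [|v|a f IH|f h IHf IHh|f h IHf IHh].
- rewrite lsub1 -mpolyC1 mderivC big1 // => v _.
  by rewrite -mpolyC1 mderivC lsub0 scaler0.
- rewrite lsubX linear_sum /= (bigD1 u) //= [X in _ + X]big1 ?addr0; last first.
    move=> w ne; rewrite mderivZ mderivX mnm1E (inj_eq enum_rank_inj) (negPf ne).
    by rewrite scale0r scaler0.
  rewrite [RHS](bigD1 v) //= [X in _ + X]big1 ?addr0; last first.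
    move=> w ne; rewrite mderivX mnm1E (inj_eq enum_rank_inj) eq_sym (negPf ne).
    by rewrite scale0r lsub0 scaler0.
  rewrite mderivZ !mderivX !mnm1E !eqxx !scale1r.
  have E k i : (U_(i) - U_(i))%MM = 0%MM :> 'X_{1..k}.
    by apply/mnmP => j; rewrite mnmBE subnn mnm0E.
  by rewrite !E !mpolyX0 lsub1.
- rewrite lsubZ mderivZ IH scaler_sumr; apply: eq_bigr => v _.
  by rewrite mderivZ lsubZ [LHS]scalerA [RHS]scalerA [a * _]mulrC.
- rewrite lsubD mderivD [X in X + _]IHf [X in _ + X]IHh -big_split.
  by apply: eq_bigr => v _; rewrite mderivD lsubD scalerDr.
rewrite lsubM mderivM [X in X * _ + _]IHf [X in _ + _ * X]IHh mulr_suml mulr_sumr -big_split; apply: eq_bigr => v _.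
 rewrite mderivM lsubD (lsubM K _ h) (lsubM K f) scalerDr.
by rewrite [X in _ = X + _]scalerAl [X in _ = _ + X]scalerAr.
Qed.

(** An operator passes through a substitution at the cost of the transposed substitution in its
    symbol. For a single derivative this is the chain rule, and sums and products of symbols
    follow. *)
Lemma diffop_lsub (q : Pol T' n') (f : Pol T n) :
  diffop q (lsub K f) = lsub K (diffop (lsub (fun u v => K v u) q) f).
Proof.
elim/Pol_ind: q f => [|u|a q IH|p q IHp IHq|p q IHp IHq] f.
- by rewrite lsub1 !diffop1.
- rewrite diffop_var mderiv_lsub lsubX diffop_suml lsub_sum; apply: eq_bigr => v _.
  by rewrite diffopZl lsubZ diffop_var.
- by rewrite lsubZ !diffopZl lsubZ IH.
- by rewrite lsubD !diffopDl lsubD [X in X + _]IHp [X in _ + X]IHq.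
by rewrite lsubM !diffopM [X in diffop p X]IHq IHp.
Qed.

Lemma lsub_mcoeff0 (f : Pol T n) : (lsub K f)@_0 = f@_0.
Proof.
elim/Pol_ind: f => [|v|a f IH|f h IHf IHh|f h IHf IHh].
- by rewrite lsub1 !mcoeff1 !eqxx.
- rewrite mcoeffX mnm1_eq0 lsubX linear_sum big1 //= => w _.
  by rewrite mcoeffZ mcoeffX mnm1_eq0 mulr0.
- by rewrite lsubZ !mcoeffZ IH.
- by rewrite lsubD !mcoeffD [X in X + _]IHf [X in _ + X]IHh.
by rewrite lsubM !rmorphM /= [X in X * _]IHf [X in _ * X]IHh.
Qed.

Lemma lsub_homog d (f : Pol T n) : f \is d.-homog -> lsub K f \is d.-homog.
Proof.
move=> fh; rewrite (homog_wordsE fh) lsub_sum; apply: rpred_sum => v _.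
rewrite lsubZ; apply: rpredZ; rewrite lsub_word; apply: rpred_sum => w _.
by apply: rpredZ; rewrite xwordE dhomogX; apply/eqP; rewrite /= mdeg_wmon card_ord.
Qed.

Lemma lsub_pihomog d (f : Pol T n) :
  lsub K (pihomog mdeg d f) = pihomog mdeg d (lsub K f).
Proof.
have [k kf] : exists k, (msize f <= k)%N by exists (msize f).
rewrite [in RHS](pihomog_partitionE kf) [f in LHS](pihomog_partitionE kf).
rewrite [in LHS]pihomog_sum [LHS]lsub_sum [in RHS]lsub_sum [RHS]pihomog_sum; apply: eq_bigr => i _.
have hi : pihomog mdeg i f \is i.-homog by apply: pihomogP.
have [->|ne] := eqVneq (i : nat) d.
  by rewrite pihomog_id [RHS]pihomog_dE //; apply: lsub_homog; apply: pihomogP.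
rewrite (@pihomog_ne0 _ _ mdeg i d) // lsub0.
by rewrite (@pihomog_ne0 _ _ mdeg i d) //; apply: lsub_homog.
Qed.

End ChainRule.

(** * The apolar pairing and invariant operators *)

Section Pairing.
Variables (T : finType) (n : nat).
Local Notation mv := (mvar T n).
Implicit Types (p q f : Pol T n).

Lemma csub_tr (g : 'M[CC]_n) (v w : mv) : csub g w v = csub g^T v w.
Proof. by rewrite /csub -trmx_inv !mxE eq_sym mulrC [in LHS]mulrC mulrC. Qed.

Lemma diffop_conj_act q (g : 'M[CC]_n) f :
  diffop q (conj_act g f) = conj_act g (diffop (conj_act g^T q) f).
Proof.
have E : conj_act g^T q = lsub (fun u v => csub g v u) q.
  by rewrite conj_actE; apply: eq_lsub => v w; rewrite [RHS]csub_tr.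
transitivity (diffop q (lsub (csub g) f)).
  exact/(congr1 (diffop q))/conj_actE.
by rewrite diffop_lsub E; symmetry; apply: conj_actE.
Qed.

(** The bilinear Fischer (apolar) pairing: distinct monomials are orthogonal, and a monomial paired
    with itself gives the product [mfact] of the factorials of its exponents. *)
Definition pair p f : CC := (diffop p f)@_0%MM.

Definition mfact (m : 'X_{1..nvar T n}) : nat := (\prod_i (m i) ^_ (m i))%N.

Lemma mfact_gt0 m : (0 < mfact m)%N.
Proof. by apply: prodn_gt0 => i; rewrite ffactnn fact_gt0. Qed.

Lemma pairE p f r : uniq r -> {subset msupp p <= r} ->
  pair p f = \sum_(m <- r) p@_m * f@_m * (mfact m)%:R.
Proof.
move=> ur sr; rewrite /pair /diffop (msupp_sum_extend _ ur sr) linear_sum /=.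
apply: eq_bigr => m _; rewrite mcoeffZ mcoeff_mderivm addm0 -mulrA; congr (_ * _).
by rewrite mulr_natr.
Qed.

Lemma pairC p f : pair p f = pair f p.
Proof.
pose r := undup (msupp p ++ msupp f).
have ur : uniq r by apply: undup_uniq.
rewrite (@pairE p f r) ?(@pairE f p r) // => [|m mf|m mp].
- by apply: eq_bigr => m _; congr (_ * _); rewrite mulrC.
- by rewrite mem_undup mem_cat mf orbT.
by rewrite mem_undup mem_cat mp.
Qed.

Lemma pair_suml (I : Type) (r : seq I) (P : pred I) (c : I -> CC) (q : I -> Pol T n) f :
  pair (\sum_(i <- r | P i) c i *: q i) f = \sum_(i <- r | P i) c i * pair (q i) f.
Proof.
rewrite /pair diffop_suml linear_sum /=; apply: eq_bigr => i _.
by rewrite diffopZl mcoeffZ.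
Qed.

Lemma pair_sumr (I : Type) (r : seq I) (P : pred I) (c : I -> CC) (q : I -> Pol T n) f :
  pair f (\sum_(i <- r | P i) c i *: q i) = \sum_(i <- r | P i) c i * pair f (q i).
Proof.
by rewrite pairC pair_suml; apply: eq_bigr => i _; rewrite pairC.
Qed.

Lemma pairM p q f : pair (p * q) f = pair p (diffop q f).
Proof. by rewrite /pair diffopM. Qed.

Lemma pair_mon q m : pair q 'X_[m] = q@_m * (mfact m)%:R.
Proof.
rewrite pairC (@pairE _ _ [:: m]) //= ?msuppX //.
by rewrite big_seq1 mcoeffX eqxx mul1r.
Qed.

(* The pairing is positive definite on polynomials with real coefficients. *)
Lemma pair_nondegenerate (O : finType) (u : O -> Pol T n) (a : O -> CC) :
  (forall o m, ((u o)@_m)^* = (u o)@_m) ->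
  (forall o, pair (u o) (\sum_o' a o' *: u o') = 0) ->
  \sum_o a o *: u o = 0.
Proof.
set f := \sum_o a o *: u o => ureal h.
pose f' := \sum_o (a o)^* *: u o.
have f'E m : f'@_m = (f@_m)^*.
  rewrite /f' /f !linear_sum rmorph_sum /=; apply: eq_bigr => o _.
  by rewrite !mcoeffZ rmorphM /= ureal.
have pos (m : 'X_{1..nvar T n}) : 0 <= f'@_m * f@_m * (mfact m)%:R.
  by rewrite f'E mulr_ge0 ?ler0n // mulrC mul_conjC_ge0.
pose r := undup (msupp f' ++ msupp f).
have : pair f' f = 0.
  by rewrite pair_suml big1 // => o _; rewrite h mulr0.
rewrite (@pairE _ _ r) ?undup_uniq //; last first.
  by move=> m mf; rewrite mem_undup mem_cat mf.
move/eqP; rewrite psumr_eq0 // => /allP z; apply/mpolyP => m; rewrite mcoeff0.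
have [mr|] := boolP (m \in r); last first.
  rewrite mem_undup mem_cat negb_or => /andP [_ nf]; exact: memN_msupp_eq0.
have := z m mr; rewrite /= f'E mulf_eq0 pnatr_eq0 eqn0Ngt mfact_gt0 orbF.
by rewrite mulrC mul_conjC_eq0 => /eqP.
Qed.

Lemma conj_act_mcoeff0 (g : 'M[CC]_n) f : (conj_act g f)@_0%MM = f@_0%MM.
Proof. by rewrite conj_actE lsub_mcoeff0. Qed.

(** Conjugation by g turns into conjugation by the transpose on symbols, and GL_n is stable under
    transposition. The symbol is recovered from its pairings with monomials. *)
Lemma inv_diffopP q : inv_diffop q <->
  forall g : 'M[CC]_n, g \in unitmx -> conj_act g q = q.
Proof.
split=> [h g gu|h g gu f]; last by rewrite diffop_conj_act h // unitmx_tr.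
apply/mpolyP => m.
have := h g^T; rewrite unitmx_tr => /(_ gu 'X_[m]).
rewrite diffop_conj_act trmxK => /(congr1 (mcoeff 0%MM)).
move=> E; have {E} : pair (conj_act g q) 'X_[m] = pair q 'X_[m].
  move: E; rewrite /pair; move: (diffop _ _) (diffop _ _) => a b.
  exact: (fun E => etrans (esym (conj_act_mcoeff0 g^T b)) (etrans E (conj_act_mcoeff0 g^T a))).
rewrite (pair_mon (conj_act g q)) (pair_mon q).
by apply: mulIf; rewrite pnatr_eq0 -lt0n mfact_gt0.
Qed.

Lemma conj_act_pihomog (g : 'M[CC]_n) d f :
  conj_act g (pihomog mdeg d f) = pihomog mdeg d (conj_act g f).
Proof. by rewrite !conj_actE lsub_pihomog. Qed.

Lemma diffop_homog q f e d : q \is e.-homog -> f \is (e + d).-homog ->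
  diffop q f \is d.-homog.
Proof.
move=> /dhomogP hq /dhomogP hf; apply/dhomogP => m.
rewrite mcoeff_msupp /diffop linear_sum /= => nz.
have /hasP [m' m'q] : has (fun m' => f@_(m' + m) != 0) (msupp q).
  apply: contraNT nz => /hasPn h; rewrite big_seq big1 // => m' /h.
  by rewrite mcoeffZ mcoeff_mderivm negbK => /eqP ->; rewrite mul0rn mulr0.
rewrite -mcoeff_msupp => /hf fe.
have e1 : mdeg m' = e := hq _ m'q.
have : (mdeg m' + mdeg m)%N = (e + d)%N by rewrite -mdegD.
by move/eqP; rewrite e1 eqn_add2l => /eqP.
Qed.

End Pairing.

(** * Products of trace products as disjoint unions of permutations *)

Section Products.
Variables (T : finType) (n : nat).

Definition sum_map (X Y : Type) (f : X -> X) (h : Y -> Y) (x : X + Y) : X + Y :=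
  match x with inl a => inl (f a) | inr b => inr (h b) end.

Lemma sum_map_inj (X Y : finType) (s : {perm X}) (t : {perm Y}) :
  injective (sum_map s t).
Proof. by move=> [a|b] [a'|b'] //= [] /perm_inj ->. Qed.

Definition sum_perm (X Y : finType) (s : {perm X}) (t : {perm Y}) : {perm X + Y} :=
  perm (@sum_map_inj X Y s t).

Definition sum_case (X Y Z : Type) (f : X -> Z) (h : Y -> Z) (x : X + Y) : Z :=
  match x with inl a => f a | inr b => h b end.

Lemma tpolyM (X Y : finType) (tau : X -> T) (tau' : Y -> T) (s : {perm X}) (t : {perm Y})
    (c : X -> 'I_n -> CC) (c' : Y -> 'I_n -> CC) :
  tpoly tau s c * tpoly tau' t c' =
  tpoly (sum_case tau tau') (sum_perm s t) (sum_case c c').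
Proof.
rewrite /tpoly mulr_suml.
under eq_bigr => I _ do rewrite mulr_sumr.
rewrite pair_bigA /=.
rewrite [RHS](reindex (fun p : {ffun X -> 'I_n} * {ffun Y -> 'I_n} =>
   [ffun z => sum_case p.1 p.2 z])) /=; last first.
  exists (fun I : {ffun X + Y -> 'I_n} => ([ffun x => I (inl x)], [ffun y => I (inr y)])).
    by move=> [I J] _ /=; congr (_, _); apply/ffunP => x; rewrite !ffunE.
  by move=> I _; apply/ffunP => -[x|y]; rewrite !ffunE /= ffunE.
apply: eq_bigr => -[I J] _ /=.
rewrite -scalerAl -scalerAr scalerA; congr (_ *: _).
  rewrite big_sumType /=; congr (_ * _); apply: eq_bigr => x _; by rewrite ffunE.
rewrite {3}/xword big_sumType /=; congr (_ * _); apply: eq_bigr => x _;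
  by rewrite !ffunE permE.
Qed.

End Products.

(** * Dimensions as ranks of matrices *)

Section Dimension.
Variable V : lmodType CC.
Implicit Types S : V -> Prop.

Lemma has_dim_le S k l : has_dim S k -> has_dim S l -> (k <= l)%N.
Proof.
move=> [v [Sv fv gv]] [w [Sw fw gw]].
have /fin_all_exists [A AE] := fun i => gw _ (Sv i).
have /fin_all_exists [B BE] := fun i => gv _ (Sw i).
pose MA : 'M[CC]_(k, l) := \matrix_(i, j) A i j.
pose MB : 'M[CC]_(l, k) := \matrix_(i, j) B i j.
have AB : MA *m MB = 1%:M.
  apply/matrixP => i i'; rewrite !mxE; apply/eqP; rewrite -subr_eq0; apply/eqP.
  move: i'; apply: (fv (fun i' => \sum_j MA i j * MB j i' - (i == i')%:R)).
  under eq_bigr => i' _ do rewrite scalerBl.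
  rewrite sumrB [X in _ - X](bigD1 i) //= eqxx scale1r [X in _ - (_ + X)]big1 ?addr0.
    rewrite [v i]AE; apply/eqP; rewrite subr_eq0; apply/eqP.
    under eq_bigr => i' _ do rewrite scaler_suml.
    rewrite exchange_big /=; apply: eq_bigr => j _.
    rewrite [w j]BE scaler_sumr; apply: eq_bigr => i' _.
    by rewrite !mxE scalerA.
  by move=> i' ne; rewrite eq_sym (negPf ne) scale0r.
have := mxrankM_maxl MA MB; rewrite AB mxrank1 => /leq_trans; apply.
exact: rank_leq_col.
Qed.

Lemma has_dim_dimS S k : has_dim S k -> dimS S = k.
Proof.
move=> h; have h' : has_dim S (dimS S).
  by apply: epsilon_spec; exists k.
by apply/eqP; rewrite eqn_leq !(has_dim_le h h', has_dim_le h' h).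
Qed.

Lemma has_dim_image N p q (u : 'I_N -> V) (G : 'M[CC]_(N, p)) (W : 'M[CC]_(q, N)) S :
  (forall c : 'rV_N, \sum_i c 0 i *: u i = 0 <-> c *m G = 0) ->
  (forall x, S x <-> exists c : 'rV_N, (c <= W)%MS /\ x = \sum_i c 0 i *: u i) ->
  has_dim S (\rank (W *m G)).
Proof.
move=> uG SW; set M := row_base (W *m G).
have ex i : exists c : 'rV_N, (c <= W)%MS /\ row i M = c *m G.
  have : (row i M <= W *m G)%MS.
    by rewrite (submx_trans (row_sub i M)) // eq_row_base.
  case/submxP => D ->; exists (D *m W); by rewrite submxMl mulmxA.
have [c cP] := fin_all_exists ex.
pose phi (x : 'rV_N) := \sum_i x 0 i *: u i.
have phiB x y : phi (x - y) = phi x - phi y.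
  by rewrite /phi -sumrB; apply: eq_bigr => i _; rewrite !mxE scalerBl.
have phi_sum (a : 'I_(\rank (W *m G)) -> CC) :
    phi (\sum_i a i *: c i) = \sum_i a i *: phi (c i).
  rewrite /phi; under [RHS]eq_bigr => i _ do rewrite scaler_sumr.
  rewrite exchange_big /=; apply: eq_bigr => j _.
  rewrite summxE scaler_suml; apply: eq_bigr => i _.
  by rewrite mxE scalerA.
have cG (a : 'I_(\rank (W *m G)) -> CC) :
    (\sum_i a i *: c i) *m G = (\row_i a i) *m M.
  rewrite mulmx_suml mulmx_sum_row; apply: eq_bigr => i _.
  by rewrite -scalemxAl -(proj2 (cP i)) mxE.
exists (fun i => phi (c i)); split.
- by move=> i; apply/SW; exists (c i); split=> //; case: (cP i).
- move=> a; rewrite -phi_sum => /uG; rewrite cG => aM i.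
  have : \row_i a i = 0.
    by apply: (row_free_inj (row_base_free (W *m G))); rewrite -/M aM mul0mx.
  by move/rowP/(_ i); rewrite !mxE.
move=> x /SW [y [yW ->]].
have /submxP [a aE] : (y *m G <= M)%MS by rewrite eq_row_base submxMr.
exists (fun i => a 0 i); rewrite -phi_sum -/(phi y).
apply/eqP; rewrite -subr_eq0 -phiB; apply/eqP/uG.
rewrite mulmxBl aE cG; apply/eqP; rewrite subr_eq0; apply/eqP; congr (_ *m _).
by apply/rowP => i; rewrite mxE.
Qed.

End Dimension.

(** * Iterated limits of bounded monotone functions *)

Section IteratedLimits.

Lemma nondecreasing_bounded_lim (f : nat -> nat) b :
  (forall k l, (k <= l)%N -> (f k <= f l)%N) -> (forall k, (f k <= b)%N) ->
  exists L, lim_nat f L.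
Proof.
move=> fm fb.
(* Induction on the room [c] left above the value at [k0]: a strict increase uses up at least one
   unit. *)
suff h c : forall k0, (forall k, (k0 <= k)%N -> (f k <= f k0 + c)%N) ->
    exists L, lim_nat f L.
  by apply: (h b 0%N) => k _; apply: leq_trans (fb k) (leq_addl _ _).
elim: c => [|c IH] k0 hk.
  exists (f k0), k0 => k kk; apply/eqP; rewrite eqn_leq (fm k0 k kk) andbT.
  by rewrite -[f k0]addn0 hk.
have [[k1 [k01 lt]]|no] := excluded_middle_informative
    (exists k1, (k0 <= k1)%N /\ (f k0 < f k1)%N).
  apply: (IH k1) => k kk; have := hk k (leq_trans k01 kk); lia.
exists (f k0), k0 => k kk; apply/eqP; rewrite eqn_leq (fm k0 k kk) andbT leqNgt.
by apply/negP => lt; apply: no; exists k.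
Qed.

(** That the limit is attained at tuples with arbitrarily large entries makes the inner limits
    monotone in the outer variable, and later identifies the limit with the stable value. *)
Lemma iter_lim_monotone m : forall (f : seq nat -> nat) b,
  (forall s t, size s = m -> size t = m ->
     (forall i, (nth 0%N s i <= nth 0%N t i)%N) -> (f s <= f t)%N) ->
  (forall s, size s = m -> (f s <= b)%N) ->
  exists L, iter_lim m f L /\
    forall N, exists s, [/\ size s = m, all (leq N) s & f s = L].
Proof.
elim: m => [|m IH] f b fm fb.
  by exists (f [::]); split=> // N; exists [::].
have ex k : exists L, iter_lim m (fun s => f (k :: s)) L /\
    forall N, exists s, [/\ size s = m, all (leq N) s & f (k :: s) = L].
  apply: (IH (fun s => f (k :: s)) b) => [s t ss st h|s ss]; last by apply: fb; rewrite /= ss.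
  by apply: fm => [||[|i]] /=; rewrite ?ss ?st.
pose L' k := proj1_sig (constructive_indefinite_description _ (ex k)).
have L'P k : iter_lim m (fun s => f (k :: s)) (L' k) /\
    forall N, exists s, [/\ size s = m, all (leq N) s & f (k :: s) = L' k].
  by rewrite /L'; case: constructive_indefinite_description.
have L'm k l : (k <= l)%N -> (L' k <= L' l)%N.
  move=> kl; have [_ /(_ 0%N) [s [ss _ <-]]] := L'P k.
  (* The tuple attaining the limit for [l] is chosen to dominate the one attaining the limit for
     [k]. *)
  have [_ /(_ (\max_(x <- s) x)) [t [st at_ <-]]] := L'P l.
  apply: fm => [||[|i]] //=; rewrite ?ss ?st //.
  have [ilt|ige] := ltnP i m; last by rewrite nth_default ?ss.
  have xt : nth 0%N t i \in t by rewrite mem_nth ?st.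
  apply: leq_trans (allP at_ _ xt).
  by apply: leq_bigmax_seq => //; rewrite mem_nth ?ss.
have L'b k : (L' k <= b)%N.
  by have [_ /(_ 0%N) [s [ss _ <-]]] := L'P k; apply: fb; rewrite /= ss.
have [L [N LN]] := nondecreasing_bounded_lim L'm L'b.
exists L; split.
  exists L'; split=> [k _|]; first by case: (L'P k).
  by exists N.
move=> N'; have [_ /(_ N') [s [ss as_ fs]]] := L'P (maxn N N').
exists (maxn N N' :: s); split; rewrite /= ?ss ?leq_maxr //.
by rewrite fs LN // leq_maxl.
Qed.

End IteratedLimits.

(** * Representatives of equivalence classes and comparison of cardinals *)

Section Representatives.
Variables (S : finType) (e : S -> S -> Prop).
Hypotheses (er : forall x, e x x) (es : forall x y, e x y -> e y x)
  (et : forall x y z, e x y -> e y z -> e x z).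

Definition propb (P : Prop) : bool := if excluded_middle_informative P then true else false.

Lemma propbP (P : Prop) : reflect P (propb P).
Proof. by rewrite /propb; case: excluded_middle_informative => h; constructor. Qed.

(** [pick] depends on its predicate only up to extensional equality, so related elements select the
    same representative. *)
Definition qrep (x : S) : S := odflt x [pick y | propb (e x y)].

Lemma qrep_rel x : e x (qrep x).
Proof. by rewrite /qrep; case: pickP => [y /propbP|]. Qed.

Lemma qrep_eq x y : e x y -> qrep x = qrep y.
Proof.
move=> exy; rewrite /qrep.
have -> : [pick z | propb (e x z)] = [pick z | propb (e y z)].
  apply: eq_pick => z; apply/propbP/propbP => h; last exact: et exy h.
  exact: et (es exy) h.
by case: pickP => // /(_ y) /propbP [].
Qed.

Lemma qrepK x : qrep (qrep x) = qrep x.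
Proof. exact/esym/qrep_eq/qrep_rel. Qed.

End Representatives.

Lemma leq_card_rel (S S' : finType) (A : pred S) (B : pred S') (r : S -> S' -> Prop) :
  (forall x, A x -> exists2 y, B y & r x y) ->
  (forall x x' y, A x -> A x' -> r x y -> r x' y -> x = x') -> (#|A| <= #|B|)%N.
Proof.
move=> ex inj.
have ex' (x : S) : exists y : option S', A x -> exists2 z, y = Some z & B z /\ r x z.
  case: (boolP (A x)) => [Ax|_]; last by exists None.
  by have [y By rxy] := ex x Ax; exists (Some y) => _; exists y.
have [f fP] := fin_all_exists ex'.
rewrite -(card_in_imset (f := f) (D := A)) => [|x x' Ax Ax' E].
  rewrite -(card_imset (f := some) B (@Some_inj _)); apply/subset_leq_card/subsetP => _ /imsetP [x Ax ->].
  by have [z -> [Bz _]] := fP x Ax; apply: imset_f.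
have [z Ez [_ rz]] := fP x Ax; have [z' Ez' [_ rz']] := fP x' Ax'.
by apply: (inj x x' z) => //; move: E; rewrite Ez Ez' => -[->].
Qed.

(** * Labelled permutations and their polynomials *)

Section LabelledPermutations.
Variable L : Type.

(** Up to this isomorphism, a labelled permutation is a multiset of necklaces, that is, of cyclic
    words in the labels. *)
Definition siso (X Y : finType) (s : {perm X}) (l : X -> L) (t : {perm Y}) (k : Y -> L) : Prop :=
  exists f : X -> Y, [/\ bijective f, forall x, f (s x) = t (f x) & forall x, k (f x) = l x].

Lemma siso_refl (X : finType) (s : {perm X}) (l : X -> L) : siso s l s l.
Proof. by exists id; split=> //; exists id. Qed.

Lemma siso_sym (X Y : finType) (s : {perm X}) (l : X -> L) (t : {perm Y}) (k : Y -> L) :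
  siso s l t k -> siso t k s l.
Proof.
move=> [f [[g fK gK] fs fl]]; exists g; split; first by exists f.
  by move=> y; apply: (can_inj fK); rewrite fs !gK.
by move=> y; rewrite -fl gK.
Qed.

Lemma siso_trans (X Y Z : finType) (s : {perm X}) (l : X -> L) (t : {perm Y})
    (k : Y -> L) (w : {perm Z}) (h : Z -> L) :
  siso s l t k -> siso t k w h -> siso s l w h.
Proof.
move=> [f [fb fs fl]] [g [gb gs gl]]; exists (g \o f); split=> [|x|x] /=.
- exact: bij_comp.
- by rewrite fs gs.
by rewrite gl fl.
Qed.

Lemma siso_ord (X : finType) (s : {perm X}) (l : X -> L) d : #|X| = d ->
  exists t : {perm 'I_d}, exists k : {ffun 'I_d -> L}, siso s l t k.
Proof.
move=> e; pose f (x : X) : 'I_d := cast_ord e (enum_rank x).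
pose g (i : 'I_d) : X := enum_val (cast_ord (esym e) i).
have fK : cancel f g by move=> x; rewrite /f /g cast_ordK enum_rankK.
have gK : cancel g f by move=> i; rewrite /f /g enum_valK cast_ordKV.
have inj : injective (fun i => f (s (g i))).
  by move=> i j /(can_inj fK) /perm_inj /(can_inj gK).
exists (perm inj), [ffun i => l (g i)], f; split=> [|x|x]; first by exists g.
  by rewrite permE fK.
by rewrite ffunE fK.
Qed.

Lemma siso_card (X Y : finType) (s : {perm X}) (l : X -> L) (t : {perm Y}) (k : Y -> L) :
  siso s l t k -> #|X| = #|Y|.
Proof. by move=> [f [fb _ _]]; apply: bij_eq_card fb. Qed.

End LabelledPermutations.

Section LabelledPolynomials.
Variables (T : finType) (n : nat) (L : Type) (tau : L -> T) (c : L -> 'I_n -> CC).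

Definition ltpoly (X : finType) (s : {perm X}) (l : X -> L) : Pol T n :=
  tpoly (fun x => tau (l x)) s (fun x => c (l x)).

Lemma ltpoly_siso (X Y : finType) (s : {perm X}) (l : X -> L) (t : {perm Y}) (k : Y -> L) :
  siso s l t k -> ltpoly s l = ltpoly t k.
Proof.
move=> [f [fb fs fl]]; rewrite /ltpoly -(tpoly_reindex _ _ fb fs).
by apply: eq_tpoly => [x|x i] /=; rewrite fl.
Qed.

Lemma ltpolyM (X Y : finType) (s : {perm X}) (l : X -> L) (t : {perm Y}) (k : Y -> L) :
  ltpoly s l * ltpoly t k = ltpoly (sum_perm s t) (sum_case l k).
Proof.
rewrite /ltpoly tpolyM; apply: eq_tpoly => [[x|x]|[x|x] i] //=.
Qed.

Lemma ltpoly_real (X : finType) (s : {perm X}) (l : X -> L) m :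
  (forall a i, (c a i)^* = c a i) -> ((ltpoly s l)@_m)^* = (ltpoly s l)@_m.
Proof.
move=> cr; rewrite /ltpoly /tpoly linear_sum rmorph_sum; apply: eq_bigr => I _ /=.
rewrite mcoeffZ xwordE mcoeffX rmorphM rmorph_nat rmorph_prod; congr (_ * _).
by apply: eq_bigr => x _; apply: cr.
Qed.

End LabelledPolynomials.

Lemma tpoly_multilinear (T L X : finType) (n : nat) (tau : X -> T) (s : {perm X})
    (M : X -> L -> CC) (c : L -> 'I_n -> CC) :
  tpoly tau s (fun x i => \sum_k M x k * c k i) =
  \sum_(l : {ffun X -> L}) (\prod_x M x (l x)) *: tpoly tau s (fun x => c (l x)).
Proof.
rewrite /tpoly; under [RHS]eq_bigr => l _ do rewrite scaler_sumr.
rewrite [RHS]exchange_big; apply: eq_bigr => I _ /=.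
rewrite bigA_distr_bigA scaler_suml; apply: eq_bigr => l _ /=.
by rewrite scalerA big_split.
Qed.

Section InvariantRestriction.
Variables (X : finType) (s : {perm X}) (P : pred X).
Hypothesis hP : forall y, P (s y) = P y.

Definition sub_map (y : {y | P y}) : {y | P y} :=
  exist _ (s (val y)) (etrans (hP (val y)) (valP y)).

Lemma sub_map_inj : injective sub_map.
Proof. by move=> y z /(congr1 val) /= /perm_inj /val_inj. Qed.

Definition sub_perm : {perm {y | P y}} := perm sub_map_inj.

Lemma val_sub_perm y : val (sub_perm y) = s (val y).
Proof. by rewrite permE. Qed.

End InvariantRestriction.

Lemma siso_split (L : Type) (X : finType) (s : {perm X}) (l : X -> L) (P : pred X)
    (hP : forall y, P (s y) = P y) (hN : forall y, ~~ P (s y) = ~~ P y) :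
  siso (sum_perm (sub_perm hP) (sub_perm hN))
    (sum_case (fun y : {y | P y} => l (val y)) (fun y : {y | ~~ P y} => l (val y))) s l.
Proof.
exists (sum_case (fun y : {y | P y} => val y) (fun y : {y | ~~ P y} => val y)); split.
- apply: inj_card_bij.
    move=> [[y hy]|[y hy]] [[z hz]|[z hz]] //= E.
    + by congr inl; apply: val_inj.
    + by case/negP: hz; rewrite -E.
    + by case/negP: hy; rewrite E.
    by congr inr; apply: val_inj.
  by rewrite card_sum !card_sig -(cardC [pred y | P y]).
- by move=> [y|y] /=; rewrite permE /= permE.
by move=> [y|y].
Qed.

(** * Invariants of the block group and harmonicity as orthogonality *)

Section BlockInvariants.
Variables (m n : nat) (bl : 'I_n -> 'I_m.+1).
Local Notation L := 'I_m.+1.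

(* Block-constant diagonal matrices have basis 1, E_1, ..., E_m: using the
   identity in place of E_0 makes full traces monomials in these generators. *)
Definition cK (b : L) (i : 'I_n) : CC := if b == ord0 then 1 else (bl i == b)%:R.

Definition uK (X : finType) (s : {perm X}) (l : X -> L) : Pol unit n :=
  ltpoly (fun=> tt) cK s l.

Lemma uK_homog (X : finType) (s : {perm X}) (l : X -> L) : uK s l \is #|X|.-homog.
Proof. exact: tpoly_homog. Qed.

Lemma uK_inv (X : finType) (s : {perm X}) (l : X -> L) g :
  block_unit bl g -> conj_act g (uK s l) = uK s l.
Proof.
move=> [gu gb]; apply: tpoly_inv => // x i j; rewrite /cK.
case: eqP => _; first by rewrite mulrC.
have [->|ne] := eqVneq (bl i) (bl j); first by rewrite mulrC.
by rewrite gb // mul0r mulr0.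
Qed.

(** Every inserted matrix is the identity, so this is a product of full traces tr(X^k). *)
Lemma uK0_inv (X : finType) (s : {perm X}) (l : X -> L) (g : 'M[CC]_n) :
  (forall x, l x = ord0) -> g \in unitmx -> conj_act g (uK s l) = uK s l.
Proof.
by move=> l0 gu; apply: tpoly_inv => // x i j; rewrite /cK l0 eqxx mulrC.
Qed.

Lemma uK_real (X : finType) (s : {perm X}) (l : X -> L) k :
  ((uK s l)@_k)^* = (uK s l)@_k.
Proof.
apply: ltpoly_real => a i; rewrite /cK.
by case: eqP => _; rewrite ?rmorph1 ?rmorph_nat.
Qed.

Lemma uK_span d (f : Pol unit n) : f \is d.-homog ->
  (forall g, block_unit bl g -> conj_act g f = f) ->
  exists a : {perm 'I_d} * {ffun 'I_d -> L} -> CC, f = \sum_o a o *: uK o.1 o.2.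
Proof.
move=> fh fi; have [a [-> _]] := first_fundamental_theorem fh fi.
(* [M] expresses the block projections in the basis [cK]: E_0 = 1 - E_1 - ... - E_m, and the other
   E_b are basis elements. *)
pose M (b k : L) : CC := if b == ord0 then (if k == ord0 then 1 else -1) else (k == b)%:R.
have ME (b : L) i : (bl i == b)%:R = \sum_k M b k * cK k i.
  rewrite /M; have [->|b0] := eqVneq b ord0; last first.
    rewrite (bigD1 b) //= [X in _ + X]big1 ?addr0; last first.
      by move=> k /negPf ->; rewrite mul0r.
    by rewrite eqxx mul1r /cK (negPf b0).
  rewrite (bigD1 ord0) //= ?eqxx mul1r {1}/cK ?eqxx.
  under eq_bigr => k /negPf k0 do rewrite k0 mulN1r /cK k0.
  rewrite sumrN; have [b0|b0] := eqVneq (bl i) ord0.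
    by rewrite big1 ?subr0 // => k k0; rewrite b0 eq_sym (negPf k0).
  rewrite (bigD1 (bl i)) //= eqxx big1 ?addr0 ?subrr // => k /andP [_ k1].
  by rewrite eq_sym (negPf k1).
exists (fun o : {perm 'I_d} * {ffun 'I_d -> L} =>
  \sum_tau \sum_b a tau o.1 b * \prod_x M (b x) (o.2 x)).
transitivity (\sum_(s : {perm 'I_d}) \sum_(l : {ffun 'I_d -> L})
  (\sum_tau \sum_b a tau s b * \prod_x M (b x) (l x)) *: uK s l); last first.
  by rewrite pair_bigA.
rewrite exchange_big /=; apply: eq_bigr => s _.
under [RHS]eq_bigr => l _ do rewrite scaler_suml.
rewrite [RHS]exchange_big /=; apply: eq_bigr => tau _.
under [RHS]eq_bigr => l _ do rewrite scaler_suml.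
rewrite [RHS]exchange_big /=; apply: eq_bigr => b _.
under [RHS]eq_bigr => l _ do rewrite -scalerA.
rewrite -scaler_sumr; congr (_ *: _).
rewrite -[RHS](tpoly_multilinear (fun=> tt) s (fun x => M (b x)) cK); apply: eq_tpoly => [x|x i]; first by case: (tau x).
exact: ME.
Qed.

(** Some cycle carries the label 0 only: the trace product has a factor tr(X^k). *)
Definition bad (X : finType) (s : {perm X}) (l : X -> L) : Prop :=
  exists x, forall i, l (iter i s x) = ord0.

Lemma bad_siso (X Y : finType) (s : {perm X}) (l : X -> L) (t : {perm Y}) (k : Y -> L) :
  siso s l t k -> bad s l -> bad t k.
Proof.
move=> [f [_ fs fl]] [x hx]; exists (f x) => i; rewrite -(hx i) -fl; congr k.
by elim: i => //= i ->; rewrite fs.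
Qed.

(** The cycle of zeros splits off as the factor [q], a full trace of positive degree. *)
Lemma bad_factor (X : finType) (s : {perm X}) (l : X -> L) : bad s l ->
  exists q p : Pol unit n, [/\ uK s l = p * q, q@_0%MM = 0 & inv_diffop q].
Proof.
move=> [x hx]; pose P := [pred y | y \in porbit s x].
have hP y : P (s y) = P y.
  by have := porbit_perm s 1 y; rewrite expg1 /= -!eq_porbit_mem => ->.
have hN y : ~~ P (s y) = ~~ P y by rewrite hP.
exists (uK (sub_perm hP) (fun y => l (val y))), (uK (sub_perm hN) (fun y => l (val y))).
split.
- rewrite /uK -(ltpoly_siso _ _ (siso_split l hP hN)) -ltpolyM mulrC //.
- have x0 : (0 < #|{: {y | P y}}|)%N.
    by apply/card_gt0P; exists (exist _ x (porbit_id s x)).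
  apply: (dhomog_nemf_coeff (uK_homog _ _)).
  by rewrite /= mdeg0 eq_sym -lt0n.
apply/inv_diffopP => g gu; apply: uK0_inv => // -[y /= /porbitP [i ->]].
by rewrite permX.
Qed.

Lemma harmonic_bad (f : PM n) : harmonic f ->
  forall (X : finType) (s : {perm X}) (l : X -> L), bad s l -> pair (uK s l) f = 0.
Proof.
move=> fh X s l /bad_factor [q [p [-> q0 qi]]].
by rewrite pairM (fh q q0 qi) /pair linear0 mcoeff0.
Qed.

Lemma diffop_homog_gt (q f : Pol unit n) e d : q \is e.-homog -> f \is d.-homog ->
  (d < e)%N -> diffop q f = 0.
Proof.
move=> /dhomogP hq /dhomogP hf lt; apply/mpolyP => k; rewrite mcoeff0.
rewrite /diffop linear_sum big_seq big1 //= => k' k'q.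
rewrite mcoeffZ mcoeff_mderivm.
suff /memN_msupp_eq0 -> : (k' + k)%MM \notin msupp f by rewrite mul0rn mulr0.
apply/negP => /hf E; have e1 : mdeg k' = e := hq _ k'q.
have : (mdeg k' + mdeg k)%N = d by rewrite -mdegD.
by move=> E'; move: lt; rewrite -E' e1 ltnNge leq_addr.
Qed.

(** The image h of [f] is again invariant under the block group, of degree d - e. Its pairing with a
    generator [uK] equals that of [f] with the product of this generator and the full traces, which
    is bad. So h is orthogonal to the generators that span it, and vanishes by
    [pair_nondegenerate]. *)
Lemma diffop_full_trace d e (f : Pol unit n) (s : {perm 'I_e}) : f \is d.-homog ->
  (forall g, block_unit bl g -> conj_act g f = f) -> (0 < e)%N ->
  (forall (t : {perm 'I_d}) (k : {ffun 'I_d -> L}), bad t k -> pair (uK t k) f = 0) ->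
  diffop (uK s (fun=> ord0)) f = 0.
Proof.
move=> fh fi e0 fb; set q := uK _ _.
have qh : q \is e.-homog by have := uK_homog s (fun=> ord0); rewrite card_ord.
have [lt|le] := ltnP d e; first exact: diffop_homog_gt qh fh lt.
have hh : diffop q f \is (d - e).-homog.
  by apply: (diffop_homog qh); rewrite subnKC.
have hi g : block_unit bl g -> conj_act g (diffop q f) = diffop q f.
  move=> gb; have := diffop_conj_act q g f; rewrite (fi g gb) => E.
  transitivity (conj_act g (diffop (conj_act g^T q) f)); last by symmetry.
  congr (conj_act _ (diffop _ _)); symmetry; apply: uK0_inv => //.
  by rewrite unitmx_tr; case: gb.
have [a aE] := uK_span hh hi; rewrite aE.
apply: pair_nondegenerate => [o k|o]; first exact: uK_real.
rewrite -aE -pairM /q /uK ltpolyM.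
have card : #|{: 'I_(d - e) + 'I_e}| = d by rewrite card_sum !card_ord subnK.
have [t [k iso]] := siso_ord (sum_perm o.1 s) (sum_case o.2 (fun=> ord0)) card.
rewrite (ltpoly_siso _ _ iso); apply: fb; apply: (bad_siso iso).
exists (inr (Ordinal e0)) => i.
suff [y ->] : exists y, iter i (sum_perm o.1 s) (inr (Ordinal e0)) = inr y by [].
elim: i => [|i [y /= ->]]; first by exists (Ordinal e0).
by rewrite permE /=; exists (s y).
Qed.

(** By the first fundamental theorem with a single block, each component of positive degree of an
    invariant symbol is a combination of products of full traces, which annihilate [f] by
    [diffop_full_trace]. *)
Lemma bad_harmonic d (f : PM n) : f \is d.-homog ->
  (forall g, block_unit bl g -> conj_act g f = f) ->
  (forall (t : {perm 'I_d}) (k : {ffun 'I_d -> L}), bad t k -> pair (uK t k) f = 0) ->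
  harmonic f.
Proof.
move=> fh fi fb q q0 /inv_diffopP qi.
rewrite (pihomog_partitionE (leqnn (msize q))) diffop_suml big1 // => -[[|e] elt] _ /=.
  suff -> : pihomog mdeg 0 q = 0 by rewrite diffop0l.
  apply/mpolyP => k; rewrite mcoeff0; have [->|k0] := eqVneq k 0%MM.
    rewrite pihomogE linear_sum big1 //= => i /eqP i0.
    have /eqP -> : i == 0%MM by rewrite -mdeg_eq0 i0.
    by rewrite q0 scale0r mcoeff0.
  apply: (dhomog_nemf_coeff (pihomogP _ 0 q)).
  by rewrite /= mdeg_eq0.
have qeh : pihomog mdeg e.+1 q \is e.+1.-homog by apply: pihomogP.
have qei (g : 'M[CC]_n) : block_unit (fun=> tt) g ->
    conj_act g (pihomog mdeg e.+1 q) = pihomog mdeg e.+1 q.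
  by move=> [gu _]; rewrite conj_act_pihomog qi.
have [a [-> _]] := first_fundamental_theorem qeh qei.
rewrite diffop_suml big1 // => tau _; rewrite diffop_suml big1 // => s _.
rewrite diffop_suml big1 // => b _; rewrite diffopZl.
have -> : ctpoly (fun=> tt) tau s b = uK s (fun=> ord0).
  apply: eq_tpoly => [x|x i]; first by case: (tau x).
  by case: (b x); rewrite /cK !eqxx.
by rewrite (diffop_full_trace (d := d)) ?scaler0.
Qed.

End BlockInvariants.

(** * Rank of a Gram matrix relative to selected rows *)

Section RankDefect.
Variables (F : fieldType) (N k : nat) (E : 'M[F]_(k, N)).

(** If the kernel of [G] is the space of relations among a family of vectors and [E] selects some of
    them, this is the dimension of the whole span minus that of the selected vectors. *)
Definition rank_defect (G : 'M[F]_N) : nat := (\rank G - \rank (E *m G))%N.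

(** On the left stands the dimension of the part of the span orthogonal to the selected vectors; as
    ker G lies in ker (G E^T), rank-nullity computes it. *)
Lemma rank_defectE (G : 'M[F]_N) : G^T = G ->
  \rank (kermx (G *m E^T) *m G) = rank_defect G.
Proof.
move=> GT; have := mxrank_mul_ker (kermx (G *m E^T)) G.
have -> : \rank (kermx (G *m E^T) :&: kermx G)%MS = \rank (kermx G).
  have /capmx_idPr : (kermx G <= kermx (G *m E^T))%MS.
    by apply/sub_kermxP; rewrite mulmxA mulmx_ker mul0mx.
  by move=> ->.
rewrite !mxrank_ker /rank_defect.
have -> : \rank (G *m E^T) = \rank (E *m G) by rewrite -mxrank_tr trmx_mul trmxK GT.
have := rank_leq_row G; have := mxrankM_maxr E G; lia.
Qed.

(** The hypothesis gives G = G' Z. Multiplying by Z costs G' the dimension of the part of its row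
    space killed by Z, and E G' has a smaller row space, so it loses no more. *)
Lemma leq_rank_defect (G G' : 'M[F]_N) :
  (forall c : 'rV_N, c *m G' = 0 -> c *m G = 0) -> (rank_defect G <= rank_defect G')%N.
Proof.
move=> h; have GE : G = G' *m (pinvmx G' *m G).
  have z : (1%:M - G' *m pinvmx G') *m G = 0.
    apply/row_matrixP => i; rewrite row_mul row0; apply: h.
    by rewrite -row_mul mulmxBl mul1mx mulmxKpV ?subrr ?row0.
  by move: z; rewrite mulmxBl mul1mx => /eqP; rewrite subr_eq0 mulmxA => /eqP.
set Z := pinvmx G' *m G in GE; rewrite /rank_defect.
have := mxrank_mul_ker G' Z; have := mxrank_mul_ker (E *m G') Z.
rewrite -mulmxA -GE.
have := mxrankS (capmxS (submxMl E G') (submx_refl (kermx Z))).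
lia.
Qed.

End RankDefect.

(** * Sums over a finite set regrouped by classes *)

Section QuotientSums.
Variables (S : finType) (e : S -> S -> Prop) (P : pred S).
Hypotheses (er : forall x, e x x) (es : forall x y, e x y -> e y x)
  (et : forall x y z, e x y -> e y z -> e x z) (eP : forall x y, e x y -> P x = P y).

Definition qreps := {x : S | (qrep e x == x) && P x}.

Definition qval (i : 'I_#|{: qreps}|) : S := val (enum_val i).

Lemma qval_inj i j : e (qval i) (qval j) -> i = j.
Proof.
move=> /(qrep_eq er es et) E; apply/enum_val_inj/val_inj; move: E; rewrite /qval.
case: (enum_val i) (enum_val j) => [x hx] [y hy] /=.
by have [/andP [/eqP -> _] /andP [/eqP -> _]] := (hx, hy).
Qed.

Lemma qval_rep x : P x -> exists i, e x (qval i).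
Proof.
move=> Px; have hx : (qrep e (qrep e x) == qrep e x) && P (qrep e x).
  by rewrite (qrepK er es et) eqxx -(eP (qrep_rel er x)).
exists (enum_rank (@exist S (fun y => (qrep e y == y) && P y) _ hx : qreps)); rewrite /qval enum_rankK /=.
exact: qrep_rel.
Qed.

Lemma qval_prop i : P (qval i).
Proof. by rewrite /qval; case: (enum_val i) => x /= /andP []. Qed.

Lemma qval_id i : qrep e (qval i) = qval i.
Proof. by rewrite /qval; case: (enum_val i) => x /= /andP [/eqP]. Qed.

Lemma sum_qreps (V : lmodType CC) (u : S -> V) (a : S -> CC) :
  (forall x y, e x y -> u x = u y) -> (forall x, ~~ P x -> a x = 0) ->
  exists b : 'I_#|{: qreps}| -> CC, \sum_x a x *: u x = \sum_i b i *: u (qval i).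
Proof.
move=> ue aP; rewrite (bigID P) /= [X in _ + X]big1 ?addr0; last first.
  by move=> x /aP ->; rewrite scale0r.
exists (fun i => \sum_(x | P x) (qrep e x == qval i)%:R * a x).
under [RHS]eq_bigr => i _ do rewrite scaler_suml.
rewrite exchange_big /=; apply: eq_bigr => x Px.
have [i0 xi] := qval_rep Px.
have E : qrep e x = qval i0 by rewrite (qrep_eq er es et xi) qval_id.
rewrite (bigD1 i0) //= [X in _ + X]big1 ?addr0.
  by rewrite E eqxx mul1r (ue _ _ xi).
move=> i /eqP ne; rewrite E; case: eqP => [E'|_]; last by rewrite mul0r scale0r.
by case: ne; apply: qval_inj; rewrite E'.
Qed.

End QuotientSums.

(** * Distinguished monomials of trace products and linear independence *)

Section Coefficients.
Variables (T : finType) (n d : nat) (L : Type) (tau : L -> T) (c : L -> 'I_n -> CC).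
Implicit Types (s : {perm 'I_d}) (l : 'I_d -> L) (I : 'I_d -> 'I_n).

Definition lmon s l I := wmon (fun x => (tau (l x), I x, I (s x))).

Lemma ltpoly_coefE s l mm : (ltpoly tau c s l)@_mm =
  \sum_(J : {ffun 'I_d -> 'I_n}) (\prod_x c (l x) (J x)) * (lmon s l J == mm)%:R.
Proof.
rewrite /ltpoly /tpoly linear_sum; apply: eq_bigr => J _ /=.
by rewrite mcoeffZ xwordE mcoeffX.
Qed.

(** For injective [I] the variables (I x, I (s x)) are the arrows of a copy of the graph of [s].
    Another word with this monomial is a rearrangement of these arrows, and the rearrangement
    carries s' to s. *)
Lemma ltpoly_coef_iso s s' l l' I : injective I ->
  (ltpoly tau c s' l')@_(lmon s l I) != 0 ->
  exists p : {perm 'I_d}, [/\ forall x, p (s' x) = s (p x),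
    forall x, tau (l' x) = tau (l (p x)) & forall x, c (l' x) (I (p x)) != 0].
Proof.
move=> injI; rewrite ltpoly_coefE => nz.
have /existsP [J] : [exists J : {ffun 'I_d -> 'I_n},
    (\prod_x c (l' x) (J x)) * (lmon s' l' J == lmon s l I)%:R != 0].
  apply: contraNT nz; rewrite negb_exists => /forallP z.
  by rewrite big1 // => J _; apply/eqP; have := z J; rewrite negbK.
rewrite mulf_eq0 negb_or => /andP [/prodf_neq0 cJ]; rewrite pnatr_eq0 eqb0 negbK.
move/eqP/wmon_perm => [p E]; exists p; split=> x; have [e1 e2 e3] := E x.
- by apply: injI; rewrite -e3; case: (E (s' x)) => _ <-.
- exact: e1.
by rewrite -e2; apply: cJ.
Qed.

(** All contributions are nonnegative, so nothing cancels the positive one of [I] itself. *)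
Lemma ltpoly_coef_self s l I : (forall a i, 0 <= c a i) -> (forall x, c (l x) (I x) != 0) ->
  (ltpoly tau c s l)@_(lmon s l I) != 0.
Proof.
move=> c0 cI; rewrite ltpoly_coefE (bigD1 [ffun x => I x]) //=.
have E : lmon s l [ffun x => I x] = lmon s l I.
  by apply: eq_wmon => x; rewrite !ffunE.
rewrite gt_eqF // ltr_pwDl //.
  rewrite E eqxx mulr1; apply: prodr_gt0 => x _.
  by rewrite ffunE lt_def cI c0.
by apply: sumr_ge0 => J _; rewrite mulr_ge0 ?ler0n // prodr_ge0.
Qed.

End Coefficients.

Lemma triangular_free (M N : nat) (u : 'I_N -> {mpoly CC[M]}) (mon : 'I_N -> 'X_{1..M})
    (rk : 'I_N -> nat) :
  (forall i, (u i)@_(mon i) != 0) ->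
  (forall i j, (u j)@_(mon i) != 0 -> j = i \/ (rk j < rk i)%N) ->
  forall c : 'I_N -> CC, \sum_i c i *: u i = 0 -> forall i, c i = 0.
Proof.
move=> d1 tri c cu i; have [k] := ubnP (rk i); elim: k i => // k IH i; rewrite ltnS => ik.
have := congr1 (mcoeff (mon i)) cu; rewrite linear_sum mcoeff0 (bigD1 i) //=.
rewrite [X in _ + X]big1 => [|j ne].
  by rewrite addr0 mcoeffZ => /eqP; rewrite mulf_eq0 (negPf (d1 i)) orbF => /eqP.
rewrite mcoeffZ; have [->|/tri [ji|lt]] := eqVneq ((u j)@_(mon i)) 0; first by rewrite mulr0.
  by rewrite ji eqxx in ne.
by rewrite IH ?mul0r // (leq_trans lt ik).
Qed.

Section LabelledReps.
Variables (L : finType) (d : nat).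

Definition lperm := ({perm 'I_d} * {ffun 'I_d -> L})%type.

Definition lrel (o o' : lperm) : Prop := siso o.1 o.2 o'.1 o'.2.

Lemma lrel_refl o : lrel o o. Proof. exact: siso_refl. Qed.

Lemma lrel_sym o o' : lrel o o' -> lrel o' o. Proof. exact: siso_sym. Qed.

Lemma lrel_trans o1 o2 o3 : lrel o1 o2 -> lrel o2 o3 -> lrel o1 o3.
Proof. exact: siso_trans. Qed.

End LabelledReps.

(** * The dimension of the harmonic invariants and its stable value *)

Section BlockDimension.
Variables (m d : nat).
Local Notation L := 'I_m.+1.
Local Notation S := (lperm L d).
Local Notation reps := (qreps (@lrel L d) predT).
Local Notation qv := (qval (e := @lrel L d) (P := predT)).

Definition bad_rep : pred 'I_#|{: reps}| := fun i => propb (bad (qv i).1 (qv i).2).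

Definition bad_mx : 'M[CC]_(#|bad_rep|, #|{: reps}|) :=
  \matrix_(a, j) (enum_val a == j)%:R.

Lemma mul_bad_trP (c : 'rV[CC]_#|{: reps}|) :
  c *m bad_mx^T = 0 <-> forall i, bad_rep i -> c 0 i = 0.
Proof.
have E a : (c *m bad_mx^T) 0 a = c 0 (enum_val a).
  rewrite mxE (bigD1 (enum_val a)) //= !mxE eqxx mulr1 big1 ?addr0 // => j ne.
  by rewrite !mxE eq_sym (negPf ne) mulr0.
split=> [h i bi|h]; last first.
  by apply/rowP => a; rewrite E mxE h //; have := enum_valP a; rewrite unfold_in.
have ib : i \in bad_rep := bi.
by have /rowP/(_ (enum_rank_in ib i)) := h; rewrite E mxE enum_rankK_in.
Qed.

Lemma bad_mx_free : row_free bad_mx.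
Proof.
apply/row_freeP; exists bad_mx^T; apply/matrixP => a b; rewrite mxE.
rewrite (bigD1 (enum_val b)) //= !mxE eqxx mulr1 big1 ?addr0.
  by rewrite (inj_eq enum_val_inj).
by move=> j ne; rewrite !mxE [enum_val b == j]eq_sym (negPf ne) mulr0.
Qed.

Section FixedBlocks.
Variables (n : nat) (bl : 'I_n -> L).

Definition uR (i : 'I_#|{: reps}|) : Pol unit n := uK bl (qv i).1 (qv i).2.

Definition gram : 'M[CC]_#|{: reps}| := \matrix_(i, j) pair (uR i) (uR j).

Lemma gram_sym : gram^T = gram.
Proof. by apply/matrixP => i j; rewrite !mxE pairC. Qed.

Lemma mul_gramE (c : 'rV[CC]_#|{: reps}|) j :
  (c *m gram) 0 j = pair (uR j) (\sum_i c 0 i *: uR i).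
Proof.
rewrite mxE pair_sumr; apply: eq_bigr => i _.
by rewrite mxE pairC.
Qed.

Lemma gram_ker (c : 'rV[CC]_#|{: reps}|) : \sum_i c 0 i *: uR i = 0 <-> c *m gram = 0.
Proof.
split=> [h|h].
  by apply/rowP => j; rewrite mul_gramE h mxE /pair linear0 mcoeff0.
apply: pair_nondegenerate => [i k|i]; first exact: uK_real.
by rewrite -mul_gramE h mxE.
Qed.

Lemma uR_span (f : Pol unit n) : f \is d.-homog ->
  (forall g, block_unit bl g -> conj_act g f = f) ->
  exists c : 'rV[CC]_#|{: reps}|, f = \sum_i c 0 i *: uR i.
Proof.
move=> fh fi; have [a aE] := uK_span fh fi.
have [b bE] := sum_qreps (@lrel_refl L d) (@lrel_sym L d) (@lrel_trans L d)
  (P := predT) (fun _ _ _ => erefl)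
  (u := fun o : S => uK bl o.1 o.2) (a := a) (fun o o' => @ltpoly_siso _ _ _ _ _ _ _ _ _ _ _)
  (fun _ (h : ~~ true) => False_ind _ (notF h)).
exists (\row_i b i); rewrite aE bE; apply: eq_bigr => i _.
by rewrite mxE.
Qed.

(** A combination with coefficient row c is harmonic exactly when c G vanishes at the bad classes,
    that is, when c lies in the kernel of G E^T with E = [bad_mx]. *)
Lemma block_harmonic_dim :
  has_dim (fun f : PM n => [/\ f \is d.-homog, harmonic f &
    forall g, block_unit bl g -> conj_act g f = f]) (rank_defect bad_mx gram).
Proof.
rewrite -rank_defectE; last exact: gram_sym.
apply: (has_dim_image gram_ker) => f; split.
  move=> [fh fharm fi]; have [c cE] := uR_span fh fi.
  exists c; split=> //; apply/sub_kermxP; rewrite mulmxA; apply/mul_bad_trP => i /propbP bi.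
  by rewrite mul_gramE -cE; apply: harmonic_bad.
move=> [c [/sub_kermxP]]; rewrite mulmxA => /mul_bad_trP h fE.
have fh : f \is d.-homog.
  rewrite fE; apply: rpred_sum => i _; apply: rpredZ.
  by have := uK_homog bl (qv i).1 (qv i).2; rewrite card_ord.
have fi g : block_unit bl g -> conj_act g f = f.
  move=> gb; rewrite fE linear_sum; apply: eq_bigr => i _.
  by rewrite linearZ /= uK_inv.
split=> //; apply: (bad_harmonic fh fi) => t k bk.
have [i iso] := qval_rep (@lrel_refl L d) (@lrel_sym L d) (@lrel_trans L d)
  (P := predT) (fun _ _ _ => erefl) (x := (t, k)) isT.
rewrite /uK (ltpoly_siso _ _ iso) fE -mul_gramE; apply: h.
by apply/propbP; apply: bad_siso iso bk.
Qed.

Hypothesis big : forall l : {ffun 'I_d -> L},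
  exists2 I : 'I_d -> 'I_n, injective I & forall x, bl (I x) = l x.

(** The monomial chosen for (s, l) has distinct indices, that of x lying in block l x. Label 0
    inserts the identity and accepts every block, so a generator can also contain monomials chosen
    for others, but only for those with more nonzero labels. The system is triangular in that
    number. *)
Lemma uR_free (c : 'I_#|{: reps}| -> CC) : \sum_i c i *: uR i = 0 -> forall i, c i = 0.
Proof.
have ex (l : {ffun 'I_d -> L}) :
    exists I : 'I_d -> 'I_n, injective I /\ forall x, bl (I x) = l x.
  by have [I] := big l; exists I.
have [I IP] := fin_all_exists ex.
have I_inj l : injective (I l) by case: (IP l).
have Il l x : bl (I l x) = l x by case: (IP l).
pose nz (i : 'I_#|{: reps}|) := #|[pred x | (qv i).2 x != ord0]|.
apply: (triangular_free (mon := fun i => lmon (fun=> tt) (qv i).1 (qv i).2 (I (qv i).2)) (rk := nz)).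
  move=> i; apply: ltpoly_coef_self => [a j|x].
    by rewrite /cK; case: ifP; rewrite ?ler01 ?ler0n.
  by rewrite /cK Il eqxx; case: ifP => _; apply: oner_neq0.
move=> i j /(ltpoly_coef_iso (I_inj _)) [p [ps _ pc]].
have pl x : (qv j).2 x != ord0 -> (qv i).2 (p x) = (qv j).2 x.
  move=> nx; have := pc x; rewrite /cK (negPf nx) Il pnatr_eq0 eqb0 negbK.
  by move/eqP.
have sub : [pred x | (qv j).2 x != ord0] \subset [pred x | (qv i).2 (p x) != ord0].
  by apply/subsetP => x; rewrite !inE => nx; rewrite pl.
have nzi : nz i = #|[pred x | (qv i).2 (p x) != ord0]|.
  by rewrite /nz -!sum1_card (reindex_inj (@perm_inj _ p)); apply: eq_bigl.
have := subset_leq_card sub; rewrite -nzi leq_eqVlt => /orP [/eqP e|]; last by right.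
left; apply: (qval_inj (@lrel_refl L d) (@lrel_sym L d) (@lrel_trans L d)).
exists p; split=> [|x|x]; first by exists (p^-1)%g; [apply: permK|apply: permKV].
  exact: ps.
have [z|nx] := eqVneq ((qv j).2 x) ord0; last exact: pl.
have /subset_cardP/(_ sub)/(_ x) : #|[pred x | (qv j).2 x != ord0]| =
    #|[pred x | (qv i).2 (p x) != ord0]| by rewrite -nzi -e.
by rewrite !inE z eqxx => /esym/eqP.
Qed.

Lemma rank_defect_stable :
  rank_defect bad_mx gram = #|[pred i | ~~ bad_rep i]|.
Proof.
have free : row_free gram.
  rewrite -kermx_eq0; apply/eqP/row_matrixP => i; rewrite row0.
  have /gram_ker h : row i (kermx gram) *m gram = 0.
    by apply/sub_kermxP; apply: row_sub.
  by apply/rowP => j; rewrite (uR_free h) mxE.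
rewrite /rank_defect (mxrankMfree _ free) (eqP bad_mx_free).
rewrite (eqP free); transitivity (#|bad_rep| + #|[predC bad_rep]| - #|bad_rep|)%N.
  by rewrite cardC card_ord.
by rewrite addKn; apply: eq_card.
Qed.

End FixedBlocks.
End BlockDimension.

(** * Restriction to smaller blocks *)

Section Embedding.
Variables (T : finType) (n n' : nat) (phi : 'I_n -> 'I_n').
Hypothesis phi_inj : injective phi.

(** Restriction of functions to the matrices supported on the rows and columns in the image of
    [phi]. *)
Definition emb_sub (v : mvar T n') (w : mvar T n) : CC :=
  (v == (w.1.1, phi w.1.2, phi w.2))%:R.

Lemma lsub_emb_var t i j : lsub emb_sub 'X_(enum_rank (t, phi i, phi j)) = 'X_(enum_rank (t, i, j)).
Proof.
rewrite lsubX (bigD1 (t, i, j)) //= [X in _ + X]big1 ?addr0.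
  by rewrite /emb_sub /= eqxx scale1r.
move=> [[t' i'] j'] ne; rewrite /emb_sub /=; case: eqP => [[et /phi_inj ei /phi_inj ej]|_].
  by rewrite et ei ej eqxx in ne.
by rewrite scale0r.
Qed.

Lemma lsub_emb_var0 t i j : i \notin codom phi ->
  lsub emb_sub ('X_(enum_rank (t, i, j)) : Pol T n') = 0.
Proof.
move=> ni; rewrite lsubX big1 // => w _; rewrite /emb_sub.
case: eqP => [[_ ei _]|_]; last by rewrite scale0r.
by rewrite ei codom_f in ni.
Qed.

Lemma lsub_emb_tpoly (X : finType) (tau : X -> T) (s : {perm X}) (c : X -> 'I_n' -> CC) :
  lsub emb_sub (tpoly tau s c) = tpoly tau s (fun x i => c x (phi i)).
Proof.
pose h (J : {ffun X -> 'I_n}) : {ffun X -> 'I_n'} := [ffun x => phi (J x)].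
have h_inj : injective h.
  by move=> J K /ffunP E; apply/ffunP => x; have := E x; rewrite !ffunE => /phi_inj.
have E (I : {ffun X -> 'I_n'}) :
    lsub emb_sub ((\prod_x c x (I x)) *: xword (fun x => (tau x, I x, I (s x)))) =
    (\prod_x c x (I x)) *: \prod_x lsub emb_sub 'X_(enum_rank (tau x, I x, I (s x))).
  by rewrite lsubZ /xword rmorph_prod.
rewrite /tpoly lsub_sum (eq_bigr _ (fun I _ => E I)).
rewrite (bigID (fun I => I \in h @: [set: {ffun X -> 'I_n}])) /= [X in _ + X]big1 ?addr0.
  rewrite big_imset /=; last by move=> J K _ _; apply: h_inj.
  apply: eq_big => [J|J _]; first by rewrite inE.
  congr (_ *: _); first by apply: eq_bigr => x _; rewrite ffunE.
  by apply: eq_bigr => x _; rewrite !ffunE lsub_emb_var.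
move=> I nI; have /existsP [x nx] : [exists x, I x \notin codom phi].
  apply: contraR nI; rewrite negb_exists => /forallP hI.
  have hI' x : I x \in codom phi by have := hI x; rewrite negbK.
  apply/imsetP; exists [ffun x => iinv (hI' x)]; rewrite ?inE //.
  by apply/ffunP => x; rewrite !ffunE f_iinv.
by rewrite [X in _ *: X](bigD1 x) //= lsub_emb_var0 // mul0r scaler0.
Qed.

End Embedding.

(** Restriction sends each generator to the generator of the same class, so relations for the larger
    blocks persist for the smaller ones and [leq_rank_defect] applies. *)
Lemma leq_gram (m d n n' : nat) (bl : 'I_n -> 'I_m.+1) (bl' : 'I_n' -> 'I_m.+1)
    (phi : 'I_n -> 'I_n') : injective phi -> (forall i, bl' (phi i) = bl i) ->
  (rank_defect (bad_mx m d) (gram d bl) <= rank_defect (bad_mx m d) (gram d bl'))%N.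
Proof.
move=> phi_inj blphi; apply: leq_rank_defect => c /gram_ker h; apply/gram_ker.
have := congr1 (lsub (emb_sub (T := unit) phi)) h; rewrite lsub0 lsub_sum => E.
rewrite -[RHS]E; apply: eq_bigr => i _; rewrite lsubZ; congr (_ *: _).
rewrite /uR /uK /ltpoly lsub_emb_tpoly //; apply: eq_tpoly => // x j.
by rewrite /cK blphi.
Qed.

(** * Block positions, monotonicity of [hdim] and the iterated limit *)

Section Blocks.

Lemma blk_cons k ns i : blk (k :: ns) i = if (i < k)%N then 0%N else (blk ns (i - k)).+1.
Proof.
rewrite /blk /= take0 /= addn0 (iotaDl 1 0) count_map.
case: ltnP => ik.
  rewrite add0n; apply/eqP; rewrite -leqn0 leqNgt -has_count; apply/hasPn => j _ /=.
  by rewrite -ltnNge ltn_addr.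
rewrite add1n; congr _.+1; apply: eq_count => j /=.
by rewrite add1n /= leq_subRL.
Qed.

Definition blk_off ns i := (i - sumn (take (blk ns i) ns))%N.

Lemma blkP ns i : (i < sumn ns)%N ->
  [/\ (blk ns i < size ns)%N, (sumn (take (blk ns i) ns) <= i)%N
    & (blk_off ns i < nth 0%N ns (blk ns i))%N].
Proof.
rewrite /blk_off; elim: ns i => //= k ns IH i; rewrite blk_cons.
case: (ltnP i k) => [ik|ki] lt /=; first by rewrite subn0.
have [|h1 h2 h3] := IH (i - k)%N; first by lia.
split=> //; last by move: h3; lia.
by move: h2; lia.
Qed.

Lemma blk_pos ns b o : (b < size ns)%N -> (o < nth 0%N ns b)%N ->
  (sumn (take b ns) + o < sumn ns)%N /\ blk ns (sumn (take b ns) + o) = b.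
Proof.
elim: ns b => //= k ns IH [_|b bs] /= ob.
  by rewrite add0n blk_cons ob; split=> //; lia.
have [h1 h2] := IH b bs ob; split; first by lia.
rewrite blk_cons; case: ltnP => [|_]; first by lia.
by congr _.+1; rewrite -[RHS]h2; congr blk; lia.
Qed.

Definition blk_ord m ns (i : 'I_(sumn ns)) : 'I_m.+1 := inord (blk ns i).

Lemma val_blk_ord m ns (i : 'I_(sumn ns)) : size ns = m.+1 -> blk_ord m i = blk ns i :> nat.
Proof. by move=> sz; rewrite inordK // -sz; case: (blkP (ltn_ord i)). Qed.

Lemma hdim_rank m d ns : size ns = m.+1 ->
  hdim ns d = rank_defect (bad_mx m d) (gram d (@blk_ord m ns)).
Proof.
move=> sz; apply: has_dim_dimS.
have [v [Sv fv gv]] := block_harmonic_dim d (@blk_ord m ns).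
have K g : @in_K ns g <-> block_unit (@blk_ord m ns) g.
  have E (i j : 'I_(sumn ns)) : (blk ns i == blk ns j) = (blk_ord m i == blk_ord m j).
    by rewrite -(inj_eq (@ord_inj _)) !val_blk_ord.
  split=> -[gu gb]; split=> // i j; first by rewrite -E; apply: gb.
  by rewrite E; apply: gb.
exists v; split=> // [i|x [xh xharm xi]].
  by have [vh vharm vi] := Sv i; split=> // g /K; apply: vi.
by apply: gv; split=> // g /K; apply: xi.
Qed.

Lemma leq_hdim m d ns ns' : size ns = m.+1 -> size ns' = m.+1 ->
  (forall i, (nth 0%N ns i <= nth 0%N ns' i)%N) -> (hdim ns d <= hdim ns' d)%N.
Proof.
move=> sz sz' le; rewrite (hdim_rank d sz) (hdim_rank d sz').
have bnd (i : 'I_(sumn ns)) : (blk ns i < size ns')%N /\ (blk_off ns i < nth 0%N ns' (blk ns i))%N.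
  have [h1 _ h2] := blkP (ltn_ord i); split; first by rewrite sz' -sz.
  exact: leq_trans h2 (le _).
have lt (i : 'I_(sumn ns)) : (sumn (take (blk ns i) ns') + blk_off ns i < sumn ns')%N.
  by have [h1 h2] := bnd i; case: (blk_pos h1 h2).
have pos (i : 'I_(sumn ns)) : blk ns' (sumn (take (blk ns i) ns') + blk_off ns i) = blk ns i.
  by have [h1 h2] := bnd i; case: (blk_pos h1 h2).
(* The embedding keeps the block of an index and its offset inside the block. *)
apply: (@leq_gram m d _ _ _ _ (fun i => Ordinal (lt i))) => [i j /(congr1 val) /= E|i].
  have eb : blk ns i = blk ns j by rewrite -pos E pos.
  apply: val_inj => /=; move: E; rewrite eb => /addnI.
  rewrite /blk_off eb.
  have [_ h1 _] := blkP (ltn_ord i); have [_ h2 _] := blkP (ltn_ord j).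
  by move: h1 h2; rewrite eb; lia.
by apply: ord_inj; rewrite !val_blk_ord //= pos.
Qed.

Lemma hdim_stable m d ns : size ns = m.+1 -> all (leq d) ns ->
  hdim ns d = #|[pred i | ~~ @bad_rep m d i]|.
Proof.
move=> sz /allP dns; rewrite (hdim_rank d sz); apply: rank_defect_stable => l.
have bnd (x : 'I_d) : (l x < size ns)%N /\ (x < nth 0%N ns (l x))%N.
  have h : (l x < size ns)%N by rewrite sz.
  by split=> //; apply: leq_trans (dns _ (mem_nth _ h)).
have lt (x : 'I_d) : (sumn (take (l x) ns) + x < sumn ns)%N.
  by have [h1 h2] := bnd x; case: (blk_pos h1 h2).
have pos (x : 'I_d) : blk ns (sumn (take (l x) ns) + x) = l x.
  by have [h1 h2] := bnd x; case: (blk_pos h1 h2).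
(* The point x goes to offset x in block [l x], which has at least d indices; equal images force
   equal blocks, hence equal offsets. *)
exists (fun x => Ordinal (lt x)) => [x y /(congr1 val) /= E|x].
  have e : l x = l y :> nat by rewrite -pos E pos.
  by apply: val_inj; move: E; rewrite e => /addnI.
by apply: ord_inj; rewrite val_blk_ord //= pos.
Qed.

Lemma hdim_iter_lim m d :
  iter_lim m.+1 (fun ns => hdim ns d) #|[pred i | ~~ @bad_rep m d i]|.
Proof.
have bnd ns : size ns = m.+1 -> (hdim ns d <= #|{: qreps (@lrel 'I_m.+1 d) predT}|)%N.
  move=> sz; rewrite (hdim_rank d sz) /rank_defect.
  exact: leq_trans (leq_subr _ _) (rank_leq_row _).
(* The limit is attained at some tuple with all entries at least d, where [hdim_stable] gives the
   value. *)
have [L [lim /(_ d) [s [ss ds sL]]]] := iter_lim_monotone (@leq_hdim m d) bnd.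
by rewrite -(hdim_stable ss ds) sL.
Qed.

End Blocks.

(** * The invariants of the weighted algebra *)

Section GradedInvariants.
Variables (m d : nat).
Local Notation T := (Acopy m d).

(* An A-structure: a permutation of at most d points labelled by copies. *)
Definition astruct := {r : 'I_d.+1 & lperm T r}.

Definition arel (o o' : astruct) : Prop :=
  siso (tagged o).1 (tagged o).2 (tagged o').1 (tagged o').2.

Lemma arel_refl o : arel o o. Proof. exact: siso_refl. Qed.

Lemma arel_sym o o' : arel o o' -> arel o' o. Proof. exact: siso_sym. Qed.

Lemma arel_trans o1 o2 o3 : arel o1 o2 -> arel o2 o3 -> arel o1 o3.
Proof. exact: siso_trans. Qed.

Definition lweight (X : finType) (l : X -> T) : nat := \sum_x (l x).1.+1.

Definition aweight (o : astruct) : bool := lweight (tagged o).2 == d.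

Lemma lweight_siso (X Y : finType) (s : {perm X}) (l : X -> T) (t : {perm Y}) (k : Y -> T) :
  siso s l t k -> lweight l = lweight k.
Proof.
move=> [f [[g fK gK] _ fl]]; rewrite /lweight [RHS](reindex f) /=; last by exists g => x _.
by apply: eq_bigr => x _; rewrite fl.
Qed.

Lemma aweight_rel o o' : arel o o' -> aweight o = aweight o'.
Proof. by move=> h; rewrite /aweight (lweight_siso h). Qed.

Definition atag (r : 'I_d.+1) (o : lperm T r) : astruct :=
  Tagged (fun r : 'I_d.+1 => lperm T r) o.

Variable n : nat.

Definition uA (o : astruct) : Pol T n :=
  ltpoly id (fun _ _ => 1) (tagged o).1 (tagged o).2.

Lemma Aweight_wmon (X : finType) (v : X -> mvar T n) :
  Aweight (wmon v) = (\sum_x (v x).1.1.1.+1)%N.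
Proof.
rewrite /Aweight; under [LHS]eq_bigr => w _ do rewrite mnm_sumE big_distrr.
rewrite exchange_big; apply: eq_bigr => x _ /=.
rewrite (bigD1 (v x)) //= mnm1E eqxx muln1 big1 ?addn0 // => w /negPf ne.
by rewrite mnm1E (inj_eq enum_rank_inj) eq_sym ne muln0.
Qed.

Lemma uA_grade o : aweight o -> in_Agrade (uA o).
Proof.
move=> /eqP wo; apply/allP => mm; rewrite mcoeff_msupp /uA ltpoly_coefE => nz.
have /existsP [J] : [exists J : {ffun 'I_(tag o) -> 'I_n},
    lmon id (tagged o).1 (tagged o).2 J == mm].
  apply: contraNT nz; rewrite negb_exists => /forallP z.
  by rewrite big1 // => J _; rewrite (negPf (z J)) mulr0.
by move/eqP <-; rewrite /lmon Aweight_wmon; apply/eqP.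
Qed.

Lemma in_Agrade_lin (I : finType) (c : I -> CC) (u : I -> Pol T n) :
  (forall i, in_Agrade (u i)) -> in_Agrade (\sum_i c i *: u i).
Proof.
move=> h; apply/allP => mm; rewrite mcoeff_msupp linear_sum /= => nz.
have [[j uj]|no] := excluded_middle_informative (exists i, (u i)@_mm != 0).
  by move: uj; rewrite -mcoeff_msupp => /(allP (h j)).
case/negP: nz; rewrite big1 // => i _.
have [z|nzi] := eqVneq ((u i)@_mm) 0; first by rewrite mcoeffZ z mulr0.
by case: no; exists i.
Qed.

(** Every variable has weight at least 1. Hence grade d bounds the degree by d, and permutations of
    at most d points suffice. *)
Lemma mdeg_Aweight (mm : 'X_{1..nvar T n}) : (mdeg mm <= Aweight mm)%N.
Proof.
rewrite mdegE /Aweight (reindex (@enum_rank (mvar T n))) /=; last exact/onW_bij/enum_rank_bij.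
by apply: leq_sum => v _; rewrite leq_pmull.
Qed.

Lemma mcoeff_pihomog0 e (p : Pol T n) mm : p@_mm = 0 -> (pihomog mdeg e p)@_mm = 0.
Proof.
move=> p0; rewrite pihomogE linear_sum big1 //= => k _.
rewrite mcoeffZ mcoeffX; case: eqP => [->|_]; last by rewrite mulr0.
by rewrite p0 mul0r.
Qed.

Lemma Ainv_span (p : Pol T n) : in_Agrade p ->
  (forall g : 'M[CC]_n, g \in unitmx -> conj_act g p = p) ->
  exists a : astruct -> CC, p = \sum_o a o *: uA o /\ forall o, ~~ aweight o -> a o = 0.
Proof.
move=> pg pinv.
have sz : (msize p <= d.+1)%N.
  rewrite msizeE; apply/bigmax_leqP_seq => mm mp _.
  by rewrite ltnS; apply: leq_trans (mdeg_Aweight mm) _; rewrite (eqP (allP pg _ mp)).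
have ex (r : 'I_d.+1) : exists a : lperm T r -> CC,
    pihomog mdeg r p = \sum_(o : lperm T r) a o *: uA (atag o) /\
    forall o : lperm T r, lweight o.2 != d -> a o = 0.
  have ph : pihomog mdeg r p \is r.-homog by apply: pihomogP.
  have pi (g : 'M[CC]_n) : block_unit (fun=> tt) g ->
      conj_act g (pihomog mdeg r p) = pihomog mdeg r p.
    by move=> [gu _]; rewrite conj_act_pihomog pinv.
  have [a [aE az]] := first_fundamental_theorem ph pi.
  exists (fun o : lperm T r => \sum_b a o.2 o.1 b); split; last first.
    (* A type of the wrong weight does not occur in [p], so the second clause of
       [first_fundamental_theorem] makes its coefficients vanish. *)
    move=> [s l] /= wl; apply: big1 => b _; apply: az => v vl.
    apply: mcoeff_pihomog0; apply/eqP; rewrite mcoeff_eq0.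
    apply: contra wl => /(allP pg); rewrite Aweight_wmon.
    by rewrite /lweight; under eq_bigr => x _ do rewrite vl.
  transitivity (\sum_s \sum_(l : {ffun 'I_r -> T}) (\sum_b a l s b) *:
      uA (@atag r (s, l))); last first.
    by rewrite pair_bigA; apply: eq_bigr => -[s l] _.
  rewrite aE exchange_big /=; apply: eq_bigr => s _; apply: eq_bigr => l _.
  rewrite scaler_suml; apply: eq_bigr => b _; congr (_ *: _).
pose A (r : 'I_d.+1) := proj1_sig (constructive_indefinite_description _ (ex r)).
have AP (r : 'I_d.+1) :
    pihomog mdeg r p = \sum_(o : lperm T r) A r o *: uA (atag o) /\
    forall o : lperm T r, lweight o.2 != d -> A r o = 0.
  exact: proj2_sig (constructive_indefinite_description _ (ex r)).
exists (fun o : astruct => A (tag o) (tagged o)); split; last first.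
  by move=> o wo; apply: (proj2 (AP (tag o))).
rewrite {1}(pihomog_partitionE sz) (eq_bigr _ (fun r _ => proj1 (AP r))).
rewrite (sig_big_dep (fun=> true) (fun _ _ => true)
  (fun (r : 'I_d.+1) (o : lperm T r) => A r o *: uA (atag o))) /=.
by apply: eq_bigr => -[r o] _.
Qed.

Local Notation areps := (qreps arel aweight).

Hypothesis dn : (d <= n)%N.

Definition awiden (r : 'I_d.+1) (i : 'I_r) : 'I_n :=
  widen_ord (leq_trans (ltn_ord r : (r <= d)%N) dn) i.

(** The variables themselves display the labels here, so a distinguished monomial occurs only in
    generators of its own class: the system is diagonal up to isomorphism. *)
Lemma uA_coef (o o' : astruct) :
  (uA o')@_(lmon id (tagged o).1 (tagged o).2 (@awiden (tag o))) != 0 -> arel o' o.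
Proof.
case: o => r [s l]; case: o' => r' [s' l'] /= nz.
have e : r' = r.
  have := tpoly_homog (n := n) (fun x => l' x) s' (fun _ _ => 1).
  rewrite card_ord => /dhomogP h; apply: ord_inj.
  have := h (lmon id s l (@awiden r)); rewrite mcoeff_msupp => /(_ nz) <-.
  by rewrite /= mdeg_wmon card_ord.
subst r'; have inj : injective (@awiden r) by move=> i j /(congr1 val) /= /val_inj.
have [p [ps pl _]] := @ltpoly_coef_iso _ n r T id (fun _ _ => 1) s s' l l' _ inj nz.
by exists p; split=> //; exists (p^-1)%g; [apply: permK|apply: permKV].
Qed.

Lemma Adim_reps : Adim m n d = #|{: areps}|.
Proof.
apply: has_dim_dimS.
pose N := #|{: areps}|; pose u (i : 'I_N) := uA (qval i).
have u0 (c : 'rV[CC]_N) : \sum_i c 0 i *: u i = 0 <-> c *m (1%:M : 'M[CC]_N) = 0.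
  rewrite mulmx1; split=> [h|->]; last by rewrite big1 // => i _; rewrite mxE scale0r.
  apply/rowP => i; rewrite mxE.
  apply: (triangular_free (u := u) (rk := fun=> 0%N) (c := fun i => c 0 i)
    (mon := fun i => lmon id (tagged (qval i)).1 (tagged (qval i)).2 (@awiden (tag (qval i)))) _ _ h).
    move=> j; apply: ltpoly_coef_self => [a k|x]; first exact: ler01.
    exact: oner_neq0.
  by move=> j k /uA_coef /(qval_inj arel_refl arel_sym arel_trans) ->; left.
have r1 : \rank (1%:M *m (1%:M : 'M[CC]_N)) = N by rewrite mulmx1 mxrank1.
rewrite -[X in has_dim _ X]r1; apply: (has_dim_image u0) => p; split.
  move=> [pg pinv]; have [a [aE az]] := Ainv_span pg pinv.
  have [b bE] := sum_qreps arel_refl arel_sym arel_trans aweight_rel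
    (u := uA) (a := a) (fun o o' => @ltpoly_siso _ _ _ _ _ _ _ _ _ _ _) az.
  exists (\row_i b i); split; first exact: submx1.
  by rewrite aE bE; apply: eq_bigr => i _; rewrite mxE.
move=> [c [_ ->]]; split.
  by apply: in_Agrade_lin => i; apply: uA_grade; apply: qval_prop.
move=> g gu; rewrite linear_sum; apply: eq_bigr => i _.
rewrite linearZ /=; congr (_ *: _); apply: tpoly_inv => // x j k.
by rewrite mulr1 mul1r.
Qed.

End GradedInvariants.

(** * Good labelled permutations against weighted ones, by first return *)

Section FirstReturn.
Variables (m d : nat).
Local Notation T := (Acopy m.+1 d).
Local Notation L := 'I_m.+1.

(* A nonzero letter followed by e zeros corresponds to a letter of weight e.+1:
   g identifies (Y, rho, tau) with the first return of s to the nonzero points. *)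
Definition unfolds (Y X : finType) (rho : {perm Y}) (tau : Y -> T) (s : {perm X})
    (l : X -> L) : Prop :=
  exists g : Y -> X,
  [/\ forall y, l (g y) = lift ord0 (tau y).2,
      forall y i, (0 < i)%N -> (i <= (tau y).1)%N -> l (iter i s (g y)) = ord0,
      forall y, iter (tau y).1.+1 s (g y) = g (rho y),
      injective g
    & forall x, exists y i, (i <= (tau y).1)%N /\ x = iter i s (g y)].

Lemma iter_perm_inj (X : finType) (s : {perm X}) i : injective (iter i s).
Proof. by elim: i => //= i IH x y /perm_inj /IH. Qed.

Lemma unfolds_siso (Y X X' : finType) (rho : {perm Y}) (tau : Y -> T) (s : {perm X})
    (l : X -> L) (s' : {perm X'}) (l' : X' -> L) :
  siso s l s' l' -> unfolds rho tau s l -> unfolds rho tau s' l'.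
Proof.
move=> [f [fb fs fl]] [g [R1 R2 R3 R4 R5]]; exists (f \o g).
have it i x : iter i s' (f x) = f (iter i s x) by elim: i => //= i ->; rewrite fs.
split=> [y|y i i0 ie|y|y y' /= /(bij_inj fb) /R4 //|x] /=.
- by rewrite fl R1.
- by rewrite it fl R2.
- by rewrite -iterS it R3.
have [k fK kK] := fb; have [y [i [ie E]]] := R5 (k x).
by exists y, i; split=> //; rewrite it -E kK.
Qed.

Lemma unfolds_siso_l (Y Y' X : finType) (rho : {perm Y}) (tau : Y -> T) (rho' : {perm Y'})
    (tau' : Y' -> T) (s : {perm X}) (l : X -> L) :
  siso rho tau rho' tau' -> unfolds rho' tau' s l -> unfolds rho tau s l.
Proof.
move=> [f [fb fs fl]] [g [R1 R2 R3 R4 R5]]; exists (g \o f).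
split=> [y|y i i0|y|y y' /= /R4 /(bij_inj fb) //|x] /=.
- by rewrite R1 fl.
- by rewrite -fl => /(R2 _ _ i0).
- by rewrite -iterS -fl R3 fs.
have [k fK kK] := fb; have [y [i [ie E]]] := R5 x.
by exists (k y), i; rewrite -fl kK.
Qed.

Lemma unfolds_lift (Y Y' X : finType) (tau : Y -> T) (tau' : Y' -> T)
    (s : {perm X}) (l : X -> L) (g : Y -> X) (g' : Y' -> X) :
  (forall y, l (g y) = lift ord0 (tau y).2) ->
  (forall y i, (0 < i)%N -> (i <= (tau' y).1)%N -> l (iter i s (g' y)) = ord0) ->
  (forall x, exists y i, (i <= (tau' y).1)%N /\ x = iter i s (g' y)) ->
  forall y, exists y', g' y' = g y.
Proof.
move=> R1 R2' R5' y; have [y' [[|i] [ie E]]] := R5' (g y); first by exists y'.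
by have := R1 y; rewrite E (R2' _ i.+1).
Qed.

(** In both structures the starting points are exactly the points of nonzero label, which matches
    them. The number of zeros after a starting point, its label and the next starting point can all
    be read off from (s, l). *)
Lemma unfolds_inj_l (Y Y' X : finType) (rho : {perm Y}) (tau : Y -> T) (rho' : {perm Y'})
    (tau' : Y' -> T) (s : {perm X}) (l : X -> L) :
  unfolds rho tau s l -> unfolds rho' tau' s l -> siso rho tau rho' tau'.
Proof.
move=> [g [R1 R2 R3 R4 R5]] [g' [R1' R2' R3' R4' R5']].
have /fin_all_exists [f fE] := unfolds_lift R1 R2' R5'.
have /fin_all_exists [k kE] := unfolds_lift R1' R2 R5.
have le : forall y, (tau' (f y)).1 = (tau y).1 :> nat.
  move=> y; apply/eqP; rewrite eqn_leq; apply/andP; split; rewrite leqNgt; apply/negP => lt.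
    have := R1 (rho y); rewrite -R3 -fE (R2' _ _ _ lt) //.
  by have := R1' (rho' (f y)); rewrite -R3' fE (R2 _ _ _ lt).
exists f; split=> [|y|y].
- by exists k => y; [apply: R4|apply: R4']; rewrite ?kE ?fE.
- by apply: R4'; rewrite fE -R3 -R3' le fE.
rewrite [LHS]surjective_pairing [RHS]surjective_pairing; congr (_, _).
  exact/ord_inj/le.
by apply: (@lift_inj _ ord0); rewrite -R1 -R1' fE.
Qed.

(** Following [s] from any point leads to the next starting point, whose label is nonzero. *)
Lemma unfolds_good (Y X : finType) (rho : {perm Y}) (tau : Y -> T) (s : {perm X})
    (l : X -> L) : unfolds rho tau s l -> ~ bad s l.
Proof.
move=> [g [R1 R2 R3 R4 R5]] [x hx]; have [y [i [ie E]]] := R5 x.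
have := R1 (rho y); rewrite -R3 -(subnK (leqW ie)) iterD -E hx.
by [].
Qed.

Section Unfolding.
Variables (Y : finType) (rho : {perm Y}) (tau : Y -> T).

(** The canonical unfolding replaces a letter of weight e+1 by e+1 points: position 0 carries the
    nonzero label, and the e others carry 0. *)
Definition unf := {p : Y * 'I_d.+1 | (p.2 <= (tau p.1).1)%N}.

Lemma card_unf : #|{: unf}| = lweight tau.
Proof.
rewrite card_sig -sum1_card /lweight.
transitivity (\sum_(y : Y) \sum_(i < d.+1 | (i < (tau y).1.+1)%N) 1)%N.
  by rewrite pair_big_dep /=; apply: eq_bigl => -[y i].
apply: eq_bigr => y _; rewrite -(big_ord_widen _ (fun=> 1%N)); last first.
  by rewrite ltnS ltnW // ltn_ord.
by rewrite sum1_card card_ord.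
Qed.

Lemma unf_val_inj (p q : unf) : (val p).1 = (val q).1 -> (val p).2 = (val q).2 :> nat -> p = q.
Proof.
case: p q => [[y i] hp] [[y' i'] hq] /= e1 e2; apply: val_inj => /=.
by rewrite e1; congr (_, _); apply: ord_inj.
Qed.

Definition ustep_val (p : Y * 'I_d.+1) : Y * 'I_d.+1 :=
  if (p.2 < (tau p.1).1)%N then (p.1, inord p.2.+1) else (rho p.1, ord0).

Lemma ustep_in (p : unf) : ((ustep_val (val p)).2 <= (tau (ustep_val (val p)).1).1)%N.
Proof.
rewrite /ustep_val; case: ltnP => //= lt; rewrite inordK // ltnS.
by apply: leq_trans lt _; rewrite ltnW.
Qed.

Definition ustep (p : unf) : unf := exist _ (ustep_val (val p)) (ustep_in p).

Lemma ustep_lt (p : unf) : ((val p).2 < (tau (val p).1).1)%N ->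
  (val (ustep p)).1 = (val p).1 /\ (val (ustep p)).2 = (val p).2.+1 :> nat.
Proof.
move=> lt; rewrite /= /ustep_val lt /= inordK // ltnS.
by apply: leq_trans lt _; rewrite ltnW.
Qed.

Lemma ustep_last (p : unf) : (val p).2 = (tau (val p).1).1 :> nat ->
  (val (ustep p)).1 = rho (val p).1 /\ (val (ustep p)).2 = 0%N :> nat.
Proof. by move=> e; rewrite /= /ustep_val e ltnn. Qed.

Lemma ustep_inj : injective ustep.
Proof.
move=> p q E.
have cs (r : unf) : ((val r).2 < (tau (val r).1).1)%N \/ (val r).2 = (tau (val r).1).1 :> nat.
  by have := valP r; rewrite leq_eqVlt => /orP [/eqP|]; [right|left].
have [/[dup] hp /ustep_lt [p1 p2]|/[dup] hp /ustep_last [p1 p2]] := cs p;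
have [/[dup] hq /ustep_lt [q1 q2]|/[dup] hq /ustep_last [q1 q2]] := cs q.
- apply: unf_val_inj; first by rewrite -p1 -q1 E.
  by apply: succn_inj; rewrite -p2 -q2 E.
- by move: p2; rewrite E q2.
- by move: q2; rewrite -E p2.
have e1 : (val p).1 = (val q).1 by apply: (@perm_inj _ rho); rewrite -p1 -q1 E.
by apply: unf_val_inj => //; rewrite hp hq e1.
Qed.

Definition uperm : {perm unf} := perm ustep_inj.

Definition ulabel (p : unf) : L :=
  if (val p).2 == ord0 then lift ord0 (tau (val p).1).2 else ord0.

Definition ustart (y : Y) : unf :=
  @exist _ (fun p : Y * 'I_d.+1 => (p.2 <= (tau p.1).1)%N) (y, ord0) (leq0n _).

Lemma iter_uperm y i : (i <= (tau y).1)%N ->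
  (val (iter i uperm (ustart y))).1 = y /\ (val (iter i uperm (ustart y))).2 = i :> nat.
Proof.
elim: i => // i IH lt; have [h1 h2] := IH (ltnW lt).
rewrite iterS permE; have [|e1 e2] := @ustep_lt (iter i uperm (ustart y)).
  by rewrite h1 h2.
by rewrite e1 e2 h1 h2.
Qed.

Lemma unfolds_unf : unfolds rho tau uperm ulabel.
Proof.
exists ustart; split=> [y|y i i0 ie|y|y y' /(congr1 (fun p => (val p).1)) //|p].
- by rewrite /ulabel eqxx.
- have [_ h] := iter_uperm ie; rewrite /ulabel.
  by rewrite -(inj_eq (@ord_inj _)) h /= eqn0Ngt i0.
- have [h1 h2] := iter_uperm (leqnn (tau y).1).
  rewrite iterS permE; have [|e1 e2] := @ustep_last (iter (tau y).1 uperm (ustart y)).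
    by rewrite h1 h2.
  by apply: unf_val_inj; rewrite ?e1 ?e2 ?h1.
exists (val p).1, (val p).2; split; first exact: (valP p).
by have [h1 h2] := iter_uperm (valP p); apply: unf_val_inj; rewrite ?h1 ?h2.
Qed.

Section Flow.
Variables (X : finType) (s : {perm X}) (l : X -> L) (g : Y -> X).
Hypotheses (R1 : forall y, l (g y) = lift ord0 (tau y).2)
  (R2 : forall y i, (0 < i)%N -> (i <= (tau y).1)%N -> l (iter i s (g y)) = ord0)
  (R3 : forall y, iter (tau y).1.+1 s (g y) = g (rho y))
  (R4 : injective g)
  (R5 : forall x, exists y i, (i <= (tau y).1)%N /\ x = iter i s (g y)).

Definition flow (p : unf) : X := iter (val p).2 s (g (val p).1).

(** Cancelling the common iterates of [s] leaves a starting point equal to a later point of a run;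
    the nonzero label forces the two positions to agree. *)
Lemma flow_le (p q : unf) : ((val p).2 <= (val q).2)%N -> flow p = flow q -> p = q.
Proof.
move=> le; rewrite /flow -(subnKC le) iterD => /iter_perm_inj E.
have := R1 (val p).1; rewrite E.
case: (posnP ((val q).2 - (val p).2)) => [z _|pos]; last first.
  by rewrite R2 //; apply: leq_trans (valP q); rewrite leq_subr.
move: E; rewrite z => /R4 e1; apply: unf_val_inj => //.
by apply/eqP; rewrite eqn_leq le /= -subn_eq0 z.
Qed.

(** Any unfolding is isomorphic to the canonical one, so the weighted structure determines the
    labelled permutation. *)
Lemma flow_siso : siso uperm ulabel s l.
Proof.
exists flow; split=> [|p|p].
- apply: inj_card_bij.
    move=> p q E; case: (leqP (val p).2 (val q).2) => [|/ltnW] h; first exact: flow_le.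
    exact/esym/flow_le.
  have /fin_all_exists [k kE] : forall x, exists p, flow p = x.
    move=> x; have [y [i [ie ->]]] := R5 x.
    by have [h1 h2] := iter_uperm ie; exists (iter i uperm (ustart y)); rewrite /flow h1 h2.
  by apply: (@leq_card _ _ k) => x x' E; rewrite -(kE x) E kE.
- rewrite permE; have := valP p; rewrite leq_eqVlt => /orP [/eqP e|lt].
    have [e1 e2] := ustep_last e.
    by rewrite /flow e1 e2 /= -R3 e iterS.
  by have [e1 e2] := ustep_lt lt; rewrite /flow e1 e2.
rewrite /flow /ulabel; case: eqP => [->|ne] /=; first exact: R1.
apply: R2; last exact: (valP p).
by rewrite lt0n; apply/eqP => z; apply: ne; apply: ord_inj.
Qed.

End Flow.
End Unfolding.

Lemma unfolds_flow (Y X : finType) (rho : {perm Y}) (tau : Y -> T) (s : {perm X})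
    (l : X -> L) : unfolds rho tau s l -> siso (uperm rho tau) (@ulabel _ tau) s l.
Proof. by move=> [g [R1 R2 R3 R4 R5]]; apply: (flow_siso R1 R2 R3 R4 R5). Qed.

(** The weighted structure is the first-return map of [s] to the points of nonzero label, each
    weighted by its return time. *)
Lemma unfolds_exists (s : {perm 'I_d}) (l : 'I_d -> L) : ~ bad s l ->
  exists o : astruct m.+1 d, unfolds (tagged o).1 (tagged o).2 s l.
Proof.
move=> good; pose Z := [pred x | l x != ord0].
pose g (y : 'I_#|Z|) : 'I_d := enum_val y.
have gZ y : l (g y) != ord0 by have := enum_valP y; rewrite inE.
have ret y : exists i, l (iter i.+1 s (g y)) != ord0.
  exists (fingraph.order s (g y)).-1; rewrite prednK ?fingraph.order_gt0 // iter_order //.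
  exact: perm_inj.
pose e y := ex_minn (ret y).
have eP y : l (iter (e y).+1 s (g y)) != ord0 by rewrite /e; case: ex_minnP.
have e_min y i : (0 < i)%N -> (i <= e y)%N -> l (iter i s (g y)) = ord0.
  rewrite /e; case: ex_minnP => k _ kmin; case: i => // i _ ik.
  by apply/eqP; apply: contraTT ik => /kmin; rewrite -ltnNge ltnS.
(* The return happens within the length of the cycle, at most d, so the number of zeros passed fits
   in ['I_d]. *)
have e_lt y : (e y < d)%N.
  rewrite /e; case: ex_minnP => k _ kmin.
  apply: (@leq_ltn_trans (fingraph.order s (g y)).-1).
    apply: kmin; rewrite prednK ?fingraph.order_gt0 // iter_order //; exact: perm_inj.
  by rewrite prednK ?fingraph.order_gt0 // (leq_trans (max_card _)) // card_ord.
have inZ y : iter (e y).+1 s (g y) \in Z by rewrite inE eP.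
pose r0 y : 'I_#|Z| := enum_rank_in (inZ y) (iter (e y).+1 s (g y)).
have gr0 y : g (r0 y) = iter (e y).+1 s (g y) by rewrite /g /r0 enum_rankK_in.
have r0_le y y' : (e y <= e y')%N -> r0 y = r0 y' -> y = y'.
  move=> le /(congr1 g); rewrite !gr0 -(subnKC le) -addSn iterD => /iter_perm_inj E.
  case: (posnP (e y' - e y)) E => [->|pos] E; first exact: enum_val_inj.
  by have := gZ y; rewrite E e_min ?eqxx // leq_subr.
have r0_inj : injective r0.
  move=> y y' E; case: (leqP (e y) (e y')) => [|/ltnW] h; first exact: r0_le.
  exact/esym/r0_le.
have ex_lab y : exists k : 'I_m, l (g y) = lift ord0 k.
  by have := gZ y; rewrite eq_sym => /unlift_some [k -> _]; exists k.
have [lab labE] := fin_all_exists ex_lab.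
have Zd : (#|Z| < d.+1)%N by rewrite ltnS -[leqRHS]card_ord max_card.
exists (@atag m.+1 d (Ordinal Zd) (perm r0_inj, [ffun y => (Ordinal (e_lt y), lab y)])).
exists g; split=> /= [y|y i|y||x].
- by rewrite ffunE labE.
- by rewrite ffunE /=; apply: e_min.
- by rewrite ffunE /= permE gr0.
- exact: enum_val_inj.
have step j y : exists y' i, (i <= e y')%N /\ iter j s (g y) = iter i s (g y').
  elim: j => [|j [y' [i [ie E]]]]; first by exists y, 0%N.
  rewrite iterS E; move: ie; rewrite leq_eqVlt => /orP [/eqP ->|lt].
    by exists (r0 y'), 0%N; rewrite /= gr0.
  by exists y', i.+1.
(* As (s, l) is good, the cycle of [x] meets [Z]; walking on from there to [x] finds the run that
   contains it. *)
have [[i nz]|no] := excluded_middle_informative (exists i, l (iter i s x) != ord0); last first.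
  case: good; exists x => i; apply/eqP; apply: contraT => nz.
  by case: no; exists i.
have zZ : iter i s x \in Z by rewrite inE.
have con : fconnect s (iter i s x) x.
  by rewrite fconnect_sym; [apply: fconnect_iter|apply: perm_inj].
have := step (findex s (iter i s x) x) (enum_rank_in zZ (iter i s x)).
rewrite {1}/g enum_rankK_in // iter_findex // => -[y' [k [kE E]]].
by exists y', k; rewrite ffunE.
Qed.

(** [unfolds] induces a bijection of classes. It is total by the canonical unfolding one way and by
    the first return the other way, and injective by [unfolds_inj_l] and [unfolds_flow]. *)
Lemma card_good_reps :
  #|{: qreps (@arel m.+1 d) (@aweight m.+1 d)}| = #|[pred i | ~~ @bad_rep m d i]|.
Proof.
pose qa := qval (e := @arel m.+1 d) (P := @aweight m.+1 d).
pose qk := qval (e := @lrel 'I_m.+1 d) (P := predT).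
pose rel i j := unfolds (tagged (qa i)).1 (tagged (qa i)).2 (qk j).1 (qk j).2.
rewrite -[LHS]card_ord; apply/eqP; rewrite eqn_leq; apply/andP; split.
  apply: (leq_card_rel (r := rel)) => [i _|i i' j _ _ h h'].
    have card : #|{: unf (tagged (qa i)).2}| = d.
      by rewrite card_unf; apply/eqP/(qval_prop i).
    have [t [k iso]] := siso_ord (uperm (tagged (qa i)).1 (tagged (qa i)).2)
      (@ulabel _ (tagged (qa i)).2) card.
    have [j jr] := qval_rep (@lrel_refl _ d) (@lrel_sym _ d) (@lrel_trans _ d)
      (P := predT) (fun _ _ _ => erefl) (x := (t, k)) isT.
    have u : rel i j.
      apply: unfolds_siso (unfolds_unf _ _); exact: siso_trans iso jr.
    by exists j => //=; apply/negP => /propbP; apply: unfolds_good u.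
  apply: (qval_inj (@arel_refl _ _) (@arel_sym _ _) (@arel_trans _ _)).
  exact: unfolds_inj_l h h'.
apply: (leq_card_rel (r := fun j i => rel i j)) => [j /propbP gj|j j' i _ _ h h'].
  have [o u] := unfolds_exists gj.
  have wo : aweight o.
    apply/eqP; rewrite -(card_unf (tagged o).2).
    by rewrite (siso_card (unfolds_flow u)) card_ord.
  have [i ir] := qval_rep (@arel_refl _ _) (@arel_sym _ _) (@arel_trans _ _)
    (@aweight_rel _ _) wo.
  by exists i => //; apply: unfolds_siso_l (arel_sym ir) u.
apply: (qval_inj (@lrel_refl _ _) (@lrel_sym _ _) (@lrel_trans _ _)).
exact: siso_trans (siso_sym (unfolds_flow h)) (unfolds_flow h').
Qed.

End FirstReturn.

Theorem theorem2 (m : nat) : (2 <= m)%N ->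
  forall d : nat, exists hd : nat,
    iter_lim m (fun ns => hdim ns d) hd /\
    lim_nat (fun n => Adim m n d) hd.
Proof.
(* With m+1 blocks there are m nonzero labels, as many as the copies of the matrix space in each
   tensor factor. *)
case: m => // m _ d; exists #|[pred i | ~~ @bad_rep m d i]|; split.
  exact: hdim_iter_lim.
by exists d => n dn; rewrite Adim_reps // card_good_reps.
Qed.
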